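(* Let $(E_n)_{n\in\mathbb{N}}$ be a betting sequence with drift certificate $(c_n)$, let $t\in\mathbb{N}$ and $\alpha\in(0,1)$, and let $C_t\in\mathbb{R}$ be a constant with $\sum_{n\le t}c_n\ge C_t$ $\mathbb{P}_1$-a.s. Assume there are constants $\underline L_n<\overline L_n$ with $$e^{\underline L_n}\le E_n\le e^{\overline L_n},\qquad\text{equivalently}\qquad\underline L_n\le L_n\le\overline L_n\qquad\mathbb{P}_1\text{-a.s.},$$ and write $r_n:=\overline L_n-\underline L_n$ (the range), $d_n:=c_n-\underline L_n\ge0$ (the downward gap) and $y_n:=\frac{d_n}{r_n}\in[0,1]$, so that $y_n$ is the position of the certified drift inside the range. Then, with $s_{\max}=\infty$, both $$\psi_n^{\mathrm{quad}}(s):=\frac{r_n^2s^2}{8}\qquad\text{and}\qquad\psi_n^{\mathrm{exact}}(s):=s\,d_n+\log\big(y_ne^{-sr_n}+1-y_n\big)$$ are majorants: the first is Hoeffding's lemma in its conditional form, the second the chord bound for $y\mapsto e^{sy}$ on the range, which is the anchored cumulant generating function of the two-point law on the endpoints. In particular $\psi_n^{\mathrm{exact}}\le\psi_n^{\mathrm{quad}}$. Moreover: (a) (Azuma–Hoeffding form.) With constants $R_t^2\ge\sum_{n\le t}r_n^2$, the rate function (of the aggregate $\Psi^{(t)}(s)=R_t^2s^2/8$) is $2x^2/R_t^2$, the optimising tilt is $s_t^{\ast}=4\Delta_t/R_t^2$, and $$\bar\gamma_t(\alpha)\le\gamma_t(\alpha)\le\exp\Big(-\frac{2\Delta_t^2}{R_t^2}\Big).$$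 (b) (Exact binary-entropy form; $\underline L_n$ and $d_n$ deterministic.) Let $r\ge\max_{n\le t}r_n$ and put $\bar y_t:=\frac1{tr}\sum_{n\le t}d_n\in[0,1]$ and $x_t:=\bar y_t-\frac{\Delta_t}{tr}$ (unlike (a), this part needs $\bar y_t$ to be a number). Then $\Psi^{(t)}(s)=t\,[\,s\,r\bar y_t+\log(\bar y_te^{-sr}+1-\bar y_t)\,]$ is an aggregate, the rate function is $t\,\mathrm{kl}\big(\bar y_t-\frac{x}{tr}\,\big\|\,\bar y_t\big)$, the optimising tilt is $$s_t^{\ast}=\frac1r\log\frac{\bar y_t(1-x_t)}{x_t(1-\bar y_t)},$$ and $$\bar\gamma_t(\alpha)\le\gamma_t(\alpha)\le\exp\Big(-t\,\mathrm{kl}\Big(\bar y_t-\frac{\Delta_t}{tr}\,\Big\|\,\bar y_t\Big)\Big).$$ Pinsker's inequality $\mathrm{kl}(x\|y)\ge2(x-y)^2$ recovers the bound $\exp(-2\Delta_t^2/(tr^2))$ from the last display.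
   Context: Conventions: $\log$ is natural, $\log0=-\infty$, $e^{-\infty}=0$; $(x)_+=\max\{x,0\}$; $\mathrm{kl}(x\|y):=x\log\frac xy+(1-x)\log\frac{1-x}{1-y}$, with the conventions $0\log0:=0$ and $\mathrm{kl}(x\|y):=+\infty$ for $x\notin[0,1]$. Setting: $(\Omega,\mathcal{F})$ is a measurable space with a filtration $(\mathcal{F}_t)_{t\in\mathbb{N}_0}$, $\mathcal{F}_0=\{\emptyset,\Omega\}$, and $\mathbb{P}_0,\mathbb{P}_1$ are probability measures with $\mathbb{P}_1|_{\mathcal{F}_t}\ll\mathbb{P}_0|_{\mathcal{F}_t}$ for all $t$. A betting sequence is a family of $\mathcal{F}_n$-measurable maps $E_n:\Omega\to[0,\infty]$ with $\mathbb{E}_{\mathbb{P}_0}[E_n\mid\mathcal{F}_{n-1}]\le1$ $\mathbb{P}_0$-a.s. Wealth: $W_0=1$, $W_t=\prod_{n\le t}E_n$; $L_n:=\log E_n$. For $\alpha\in(0,1)$: $\ell:=\log\frac1\alpha$, $\tau_\alpha:=\inf\{t\in\mathbb{N}:W_t>\frac1\alpha\}$, $\gamma_t(\alpha):=\mathbb{P}_1(W_t\le\frac1\alpha)$, $\bar\gamma_t(\alpha):=\mathbb{P}_1(\tau_\alpha>t)$; $\Delta_t:=(C_t-\ell)_+$. Drift certificate: real random variables $c_n$, $\mathcal{F}_{n-1}$-measurable, with $\mathbb{E}_{\mathbb{P}_1}[L_n\mid\mathcal{F}_{n-1}]\ge c_n$ $\mathbb{P}_1$-a.s. The anchored conditional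 cumulant generating function is $\varphi_n(s):=\log\mathbb{E}_{\mathbb{P}_1}[e^{-s(L_n-c_n)}\mid\mathcal{F}_{n-1}]$ for $s\ge0$. Majorant on $[0,s_{\max})$: maps $\psi_n:[0,s_{\max})\times\Omega\to[0,\infty]$ with $\psi_n(s)$ $\mathcal{F}_{n-1}$-measurable, $\psi_n(0)=0$, and $\varphi_n(s)\le\psi_n(s)$ $\mathbb{P}_1$-a.s. for all $n$, $s$. Aggregate (at horizon $t$): deterministic $C_t$, $\Psi^{(t)}$ with $\sum_{n\le t}c_n\ge C_t$ and $\sum_{n\le t}\psi_n(s)\le\Psi^{(t)}(s)$ $\mathbb{P}_1$-a.s. for all $s\in[0,s_{\max})$. Rate function: $(\Psi^{(t)})^{\star}(x):=\sup_{s\in[0,s_{\max})}\{sx-\Psi^{(t)}(s)\}$, $x\ge0$; the optimising tilt is a maximiser of this supremum at $x=\Delta_t$.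
   Formalization: The displayed d_n ≥ 0 is taken as an assumption (P_1-a.s.), since a drift certificate c_n may lie below the lower endpoint, where d_n < 0 and ψ_n^exact is negative; ψ_n^exact is set to 0 on the null event where y_n is outside [0,1]. *)

(* Defs.v *)
From HB Require Import structures.
From mathcomp Require Export all_boot all_order all_algebra.
From mathcomp Require Export all_classical all_reals all_analysis measurable_realfun.

Set Implicit Arguments.
Unset Strict Implicit.
Unset Printing Implicit Defensive.

Export Order.TTheory GRing.Theory Num.Theory.
Export numFieldNormedType.Exports.

#[global] Open Scope classical_set_scope.
#[global] Open Scope ring_scope.

(* Discrete time: filtrations are indexed from 0, all other processes from 1;
   their value at index 0 is never used. Sums and products over n <= t run
   over 1 <= n <= t. *)

Definition sub_measurable d (T : measurableType d) d' (U : measurableType d')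
    (G : set (set T)) (f : T -> U) : Prop :=
  measurable_fun [set: g_sigma_algebraType G] (f : g_sigma_algebraType G -> U).

Definition filtration d (T : measurableType d) (F : nat -> set (set T)) : Prop :=
  [/\ forall n, sigma_algebra setT (F n),
      forall n, F n `<=` measurable,
      forall m n, (m <= n)%N -> F m `<=` F n
    & F 0%N = [set set0; setT]].

Definition locally_dominated d (T : measurableType d) (R : realType)
    (P0 P1 : probability T R) (F : nat -> set (set T)) : Prop :=
  forall t A, F t A -> P0 A = 0%E -> P1 A = 0%E.

Section conditional_expectation.
Local Open Scope ereal_scope.

Definition is_cond_exp_ge0 d (T : measurableType d) (R : realType)
    (P : probability T R) (G : set (set T)) (f g : T -> \bar R) : Prop :=
  [/\ sub_measurable G g, forall w, 0 <= g w
    & forall A, G A -> \int[P]_(w in A) g w = \int[P]_(w in A) f w].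

(* g is a version of E_P[f | G], for f with values in [-oo, +oo]; the
   condition that E[f^+ | G] and E[f^- | G] are not both infinite makes the
   difference meaningful. *)
Definition is_cond_exp d (T : measurableType d) (R : realType)
    (P : probability T R) (G : set (set T)) (f g : T -> \bar R) : Prop :=
  sub_measurable G g /\
  exists gp gm : T -> \bar R,
    [/\ is_cond_exp_ge0 P G f^\+ gp, is_cond_exp_ge0 P G f^\- gm,
        {ae P, forall w, gp w < +oo \/ gm w < +oo}
      & {ae P, forall w, g w = gp w - gm w}].

End conditional_expectation.

Section betting.
Local Open Scope ereal_scope.

Definition betting_sequence d (T : measurableType d) (R : realType)
    (P0 : probability T R) (F : nat -> set (set T)) (E : nat -> T -> \bar R) : Prop :=
  forall n, (0 < n)%N ->
    [/\ sub_measurable (F n) (E n), forall w, 0 <= E n w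
      & exists2 g, is_cond_exp P0 (F n.-1) (E n) g & {ae P0, forall w, g w <= 1}].

Definition wealth (T : Type) (R : realType) (E : nat -> T -> \bar R) (t : nat) (w : T)
    : \bar R :=
  \prod_(1 <= n < t.+1) E n w.

Definition logE (T : Type) (R : realType) (E : nat -> T -> \bar R) (n : nat) (w : T)
    : \bar R :=
  lne (E n w).

(* The infimum of the empty set is +oo. *)
Definition tau (T : Type) (R : realType) (E : nat -> T -> \bar R) (alpha : R) (w : T)
    : \bar R :=
  ereal_inf [set n%:R%:E | n in [set n : nat | (0 < n)%N /\ (alpha^-1)%:E < wealth E n w]].

Definition type2 d (T : measurableType d) (R : realType) (P1 : probability T R)
    (E : nat -> T -> \bar R) (alpha : R) (t : nat) : \bar R :=
  P1 [set w | wealth E t w <= (alpha^-1)%:E].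

Definition type2_seq d (T : measurableType d) (R : realType) (P1 : probability T R)
    (E : nat -> T -> \bar R) (alpha : R) (t : nat) : \bar R :=
  P1 [set w | t%:R%:E < tau E alpha w].

Definition excess (R : realType) (alpha C : R) : R := Num.max (C - ln alpha^-1)%R 0%R.

Definition drift_certificate d (T : measurableType d) (R : realType)
    (P1 : probability T R) (F : nat -> set (set T)) (E : nat -> T -> \bar R)
    (c : nat -> T -> R) : Prop :=
  forall n, (0 < n)%N ->
    sub_measurable (F n.-1) (c n) /\
    exists2 g, is_cond_exp P1 (F n.-1) (logE E n) g
             & {ae P1, forall w, (c n w)%:E <= g w}.

(* phi is a version of the anchored conditional cumulant generating function
   log E_P1[exp(-s (L_n - c_n)) | F_(n-1)]. *)
Definition is_anchored_cgf d (T : measurableType d) (R : realType)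
    (P1 : probability T R) (F : nat -> set (set T)) (E : nat -> T -> \bar R)
    (c : nat -> T -> R) (n : nat) (s : R) (phi : T -> \bar R) : Prop :=
  exists2 g,
    is_cond_exp P1 (F n.-1) (fun w => expeR (- s%:E * (logE E n w - (c n w)%:E))) g
    & forall w, phi w = lne (g w).

Definition tilt_dom (R : realType) (smax : \bar R) : set R :=
  [set s : R | (0 <= s)%R /\ s%:E < smax].

Definition is_majorant d (T : measurableType d) (R : realType)
    (P1 : probability T R) (F : nat -> set (set T)) (E : nat -> T -> \bar R)
    (c : nat -> T -> R) (smax : \bar R) (psi : nat -> R -> T -> \bar R) : Prop :=
  forall n, (0 < n)%N ->
    (forall w, psi n 0%R w = 0) /\
    forall s, tilt_dom smax s ->
      [/\ forall w, 0 <= psi n s w,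
          sub_measurable (F n.-1) (psi n s)
        & exists2 phi, is_anchored_cgf P1 F E c n s phi
                     & {ae P1, forall w, phi w <= psi n s w}].

Definition is_aggregate d (T : measurableType d) (R : realType)
    (P1 : probability T R) (c : nat -> T -> R) (smax : \bar R)
    (psi : nat -> R -> T -> \bar R) (t : nat) (C : R) (Psi : R -> \bar R) : Prop :=
  {ae P1, forall w, (C <= \sum_(1 <= n < t.+1) c n w)%R} /\
  forall s, tilt_dom smax s ->
    {ae P1, forall w, \sum_(1 <= n < t.+1) psi n s w <= Psi s}.

Definition rate (R : realType) (smax : \bar R) (Psi : R -> \bar R) (x : R) : \bar R :=
  ereal_sup [set (s * x)%:E - Psi s | s in tilt_dom smax].

Definition is_optimal_tilt (R : realType) (smax : \bar R) (Psi : R -> \bar R)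
    (x s : R) : Prop :=
  tilt_dom smax s /\ (s * x)%:E - Psi s = rate smax Psi x.

End betting.

Section entropy.
Local Open Scope ereal_scope.

(* a log (a / b), with 0 log (0 / b) = 0 and a log (a / 0) = +oo for a > 0 *)
Definition xlogx_div (R : realType) (a b : R) : \bar R :=
  if a == 0%R then 0
  else if b == 0%R then +oo
  else (a * ln (a / b))%:E.

(* binary relative entropy, for y in [0, 1] *)
Definition kl (R : realType) (x y : R) : \bar R :=
  if (0 <= x <= 1)%R then xlogx_div x y + xlogx_div (1 - x) (1 - y) else +oo.

End entropy.

Definition log_range (R : realType) (lo up : nat -> R) (n : nat) : R := up n - lo n.

Definition gap (T : Type) (R : realType) (lo : nat -> R) (c : nat -> T -> R)
    (n : nat) (w : T) : R :=
  c n w - lo n.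

Definition position (T : Type) (R : realType) (lo up : nat -> R) (c : nat -> T -> R)
    (n : nat) (w : T) : R :=
  gap lo c n w / log_range lo up n.

Definition psi_quad (T : Type) (R : realType) (lo up : nat -> R)
    (n : nat) (s : R) (w : T) : \bar R :=
  (log_range lo up n ^+ 2 * s ^+ 2 / 8)%:E.

(* The position lies in [0, 1] only P1-almost surely; outside [0, 1] the
   formula can be negative or take the logarithm of a nonpositive number, and
   the value 0 is used instead, so that psi_exact is [0, +oo]-valued
   everywhere. *)
Definition psi_exact (T : Type) (R : realType) (lo up : nat -> R) (c : nat -> T -> R)
    (n : nat) (s : R) (w : T) : \bar R :=
  let y := position lo up c n w in
  if 0 <= y <= 1 then
    (s * gap lo c n w + ln (y * expR (- (s * log_range lo up n)) + 1 - y))%:E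
  else 0%E.

Definition Psi_quad (R : realType) (R2 s : R) : \bar R := (R2 * s ^+ 2 / 8)%:E.

Definition Psi_exact (R : realType) (t : nat) (r y s : R) : \bar R :=
  (t%:R * (s * r * y + ln (y * expR (- (s * r)) + 1 - y)))%:E.

(* Main.v *)
Require Import Defs.
From HB Require Import structures.
From mathcomp Require Import ring lra.

(* Conditionally on F_(n-1), clip the log-increment L_n and the drift c_n to
   the range: D_n = L_n - lo_n and U_n = c_n - lo_n lie in [0, r_n], and the
   drift certificate says that U_n integrates to at most D_n over every
   F_(n-1)-event. Convexity bounds exp(- s D_n) by the chord, a nonincreasing
   affine function of D_n, so its conditional expectation is at most the chord
   at U_n. Multiplying by the F_(n-1)-measurable factor exp(s U_n) gives
   exp(psi_exact), which Hoeffding's lemma for the two-point law on the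
   endpoints bounds by exp(psi_quad). Iterating over n bounds the exponential
   moment of sum (U_n - D_n), and a Chernoff bound at tilt s controls the type-II
   error; optimising over s gives the rate functions. The binary relative
   entropy is the conjugate of the two-point cumulant generating function, so
   Pinsker's inequality is the conjugate of Hoeffding's lemma. *)

Set Implicit Arguments.
Unset Strict Implicit.
Unset Printing Implicit Defensive.

Import HBNNSimple.

(** * Two-point laws: the chord bound and Hoeffding's lemma *)

Lemma deriv_ge0 (R : realType) (f df : R -> R) :
  (forall x : R, 0 <= x -> is_derive x (1 : R) f (df x)) ->
  (forall x : R, 0 <= x -> 0 <= df x) -> 0 <= f 0 ->
  forall x : R, 0 <= x -> 0 <= f x.
Proof.
move=> dfE df0 f0 x x0.
have [||c] := @MVT_segment _ f df 0 x x0.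
- by move=> z; rewrite in_itv/= => /andP[/ltW z0 _]; exact: dfE.
- apply: derivable_within_continuous => z; rewrite in_itv/= => /andP[z0 _].
  exact/ex_derive/dfE.
- rewrite in_itv/= => /andP[c0 _] /eqP; rewrite subr_eq => /eqP ->.
  by rewrite addr_ge0// mulr_ge0 ?subr0// df0.
Qed.

Section twopoint.
Context {R : realType}.
Implicit Types y p u : R.

Lemma two_point_gt0 y u : (0 <= y <= 1) -> (0 < y * expR (- u) + 1 - y).
Proof. move=> y01; have := expR_gt0 (- u); nra. Qed.

(* Tangent lines of exp at exponents [- (1 - y) u] and [y u]. *)
Lemma expR_chord y u : 0 <= y <= 1 -> expR (- (y * u)) <= y * expR (- u) + 1 - y.
Proof.
move=> y01; rewrite -(@ler_pM2r _ (expR (y * u))) ?expR_gt0//.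
rewrite -expRD addNr expR0.
have -> : (y * expR (- u) + 1 - y) * expR (y * u) =
    y * expR (- u + y * u) + (1 - y) * expR (y * u) by rewrite expRD; ring.
have h1 := expR_ge1Dx (- u + y * u); have h2 := expR_ge1Dx (y * u).
nra.
Qed.

(** The difference [f] of the two sides vanishes at 0 together with its derivative [g], and its
    second derivative is [1/4 - q (1 - q) = (q - 1/2)^2], where [q] is the mass of the lower
    exponent [- u] under the exponentially tilted law. Two applications of [deriv_ge0] conclude. *)
Lemma hoeffding_two_point y u : 0 <= y <= 1 -> 0 <= u ->
  y * u + ln (y * expR (- u) + 1 - y) <= u ^+ 2 / 8.
Proof.
move=> y01; pose Z (u : R) := y * expR (- u) + 1 - y.
(* Writing the tilted mass [y e^(-u) / Z] as one exponential makes its derivative a multiple of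
   itself, [q (q - 1)]. *)
pose q (u : R) := y * expR (- u - ln (Z u)).
have Z0 (v : R) : 0 < Z v by exact: two_point_gt0.
have dZ (v : R) : is_derive v (1 : R) Z (- (y * expR (- v))).
  have -> : Z = (cst y * (expR \o -%R) + cst (1 - y)).
    by apply/funext => z; rewrite /Z addrA.
  by apply: is_derive_eq; rewrite scaler0 addr0 addr0 /= mulrN1 /GRing.scale/= mulrN.
have dlnZ (v : R) : 0 <= v ->
    is_derive v (1 : R) (@ln R \o Z) ((Z v)^-1 * - (y * expR (- v))).
  by move=> v0; apply: is_derive1_comp; apply: is_derive1_ln; exact: Z0.
have qE (v : R) : 0 <= v -> q v = (Z v)^-1 * (y * expR (- v)).
  by move=> v0; rewrite /q expRB lnK ?posrE ?Z0// [RHS]mulrC mulrA.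
have dq (v : R) : 0 <= v -> is_derive v (1 : R) q (q v * (- 1 + q v)).
  move=> v0.
  have -> : q = (cst y * (expR \o (-%R - (@ln R \o Z)))) by [].
  have := dlnZ v v0 => ?.
  apply: is_derive_eq; rewrite /= scaler0 addr0 /GRing.scale/= mulrA -/(q v) mulrN opprK.
  by rewrite -qE// /q addrC.
suff H (v : R) : 0 <= v -> 0 <= v / 4 - y + q v.
  pose f (v : R) := v ^+ 2 / 8 - y * v - ln (Z v).
  suff f0 : forall v : R, 0 <= v -> 0 <= f v.
    by move=> /f0; rewrite subr_ge0 lerBrDl.
  apply: (@deriv_ge0 _ f (fun v => v / 4 - y + q v)).
  - move=> x x0.
    have -> : f = 8^-1 \*: (id ^+ 2 : R -> R) - y \*: (id : R -> R) - (@ln R \o Z).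
      by apply/funext => z; rewrite /f mulrC.
    have := dlnZ x x0 => ?.
    apply: is_derive_eq; rewrite mulrN -qE// opprK /GRing.scale/= !mulr1.
    by congr (_ + _); field.
  - exact: H.
  - by rewrite /f /Z oppr0 expR0 mulr1 [y + 1]addrC addrK expr0n/= mul0r mulr0 ln1 !subr0.
pose g (v : R) := v / 4 - y + q v.
suff g0 : forall v : R, 0 <= v -> 0 <= g v by exact: g0.
apply: (@deriv_ge0 _ g (fun v => 1 / 4 + q v * (- 1 + q v))).
- move=> x x0; have := dq x x0 => ?.
  have -> : g = 4^-1 \*: (id : R -> R) - cst y + q.
    by apply/funext => z; rewrite /g mulrC.
  by apply: is_derive_eq; rewrite subr0 /GRing.scale/= mulr1 mul1r.
- by move=> x x0; have := sqr_ge0 (q x - 1 / 2); nra.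
- by rewrite /g /q /Z oppr0 expR0 mulr1 [y + 1]addrC addrK ln1 subr0 expR0 mulr1; lra.
Qed.

End twopoint.

(** * Binary relative entropy as a convex conjugate *)

Section kl.
Context {R : realType}.
Implicit Types a b y p u m : R.
Local Open Scope ereal_scope.

Lemma ln_le_sub1 (x : R) : (0 < x)%R -> (ln x <= x - 1)%R.
Proof.
move=> x0; have := @le_ln1Dx _ (x - 1)%R; rewrite addrCA subrr addr0; apply.
by rewrite ltrBrDr addrC subrr.
Qed.

(* Young's inequality for the convex conjugate pair [a ln a - a] and [exp]. *)
Lemma xlogx_div_ge a b m : (0 <= a)%R -> (0 <= b)%R -> (0 < m)%R ->
  (a * ln m + a - b * m)%:E <= xlogx_div a b.
Proof.
move=> a0 b0 m0; rewrite /xlogx_div; case: eqVneq => [->|an0].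
  by rewrite lee_fin !mul0r add0r sub0r oppr_le0 mulr_ge0// ltW.
case: eqVneq => [//|bn0]; first by rewrite leey.
have {an0}a0 : (0 < a)%R by rewrite lt_neqAle eq_sym an0.
have {bn0}b0 : (0 < b)%R by rewrite lt_neqAle eq_sym bn0.
rewrite lee_fin.
have h : (ln (b * m / a) <= b * m / a - 1)%R.
  by rewrite ln_le_sub1// divr_gt0 ?mulr_gt0.
have -> : (b * m = a * (b * m / a))%R by field; rewrite gt_eqF.
move: h; rewrite ln_div ?posrE ?mulr_gt0// lnM ?posrE// ln_div ?posrE// => h.
rewrite -subr_ge0.
have -> : (a * (ln a - ln b) - (a * ln m + a - a * (b * m / a)) =
  a * (b * m / a - 1 - (ln b + ln m - ln a)))%R by ring.
by rewrite mulr_ge0 ?subr_ge0// ltW.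
Qed.

(** Young's inequality is applied to each outcome, with [m] the likelihood ratio [expR (- u) / Z] or
    [1 / Z] of the tilted law. The tilted masses add up to 1, so the linear terms cancel. *)
Lemma kl_ge p y u : (0 <= y <= 1)%R ->
  (- (u * p) - ln (y * expR (- u) + 1 - y))%:E <= kl p y.
Proof.
move=> y01; rewrite /kl; case: ifPn => [/andP[p0 p1]|_]; last by rewrite leey.
have Z0 := @two_point_gt0 _ y u y01; set Z := (X in ln X) in Z0 *.
have /andP[y0 y1] := y01.
have := @xlogx_div_ge p y (expR (- u) / Z) p0 y0.
rewrite divr_gt0 ?expR_gt0// => /(_ isT) h1.
have := @xlogx_div_ge (1 - p) (1 - y) (Z^-1); rewrite !subr_ge0 p1 y1 invr_gt0 Z0.
move=> /(_ isT isT isT) h2; apply: le_trans (leeD h1 h2).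
rewrite -EFinD lee_fin ln_div ?posrE ?expR_gt0// expRK lnV ?posrE//.
rewrite le_eqVlt; apply/orP; left; apply/eqP.
have -> : (y * (expR (- u) / Z) = 1 - (1 - y) / Z)%R.
  rewrite -[X in (X - _)%R](divff (lt0r_neq0 Z0)) -mulrBl mulrA.
  by congr (_ / _)%R; rewrite /Z; ring.
by ring.
Qed.

(** This [u] is the tilt that moves the mean from [y] to [p]: the likelihood ratios become [p / y]
    and [(1 - p) / (1 - y)], the equality case of Young's inequality. *)
Lemma kl_attained p y : (0 < p < 1)%R -> (0 < y < 1)%R ->
  let u := ln (y * (1 - p) / (p * (1 - y))) in
  kl p y = (- (u * p) - ln (y * expR (- u) + 1 - y))%:E.
Proof.
move=> /andP[p0 p1] /andP[y0 y1] u.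
have p'0 : (0 < 1 - p)%R by rewrite subr_gt0.
have y'0 : (0 < 1 - y)%R by rewrite subr_gt0.
have -> : (y * expR (- u) + 1 - y = (1 - y) / (1 - p))%R.
  rewrite expRN lnK ?posrE ?divr_gt0 ?mulr_gt0//; field.
  by rewrite !gt_eqF.
rewrite /kl !ltW//= /xlogx_div !gt_eqF// -EFinD; congr _%:E.
rewrite /u !(ln_div, lnM) ?posrE ?mulr_gt0//; ring.
Qed.

(** Symmetry under exchange of the two outcomes; it reduces Pinsker's inequality to the case where
    the first argument is the smaller one. *)
Lemma klC p y : kl (1 - p) (1 - y) = kl p y.
Proof.
rewrite /kl !subKr; have -> : (0 <= 1 - p <= 1)%R = (0 <= p <= 1)%R by apply/idP/idP; lra.
by case: ifP => // _; rewrite addeC.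
Qed.

(** Nonnegative tilts suffice because [p <= y] makes the maximising log odds ratio nonnegative. On
    the boundary the supremum may be infinite or only approached, hence the case analysis for the
    lower bound. *)
Lemma kl_sup p y : (0 <= y <= 1)%R -> (p <= y)%R ->
  ereal_sup [set (- (u * p) - ln (y * expR (- u) + 1 - y))%:E | u in [set u | (0 <= u)%R]]
  = kl p y.
Proof.
move=> y01 py; apply/eqP; rewrite eq_le; apply/andP; split.
  by apply: ge_ereal_sup => _ [u /= _ <-]; exact: kl_ge.
have /andP[y0 y1] := y01.
(* Linear growth of the objective in [u] forces the supremum to be infinite. *)
have unbounded k : (0 < k)%R ->
    (forall u, (0 <= u)%R -> (k * u <= - (u * p) - ln (y * expR (- u) + 1 - y))%R) ->
    ereal_sup [set (- (u * p) - ln (y * expR (- u) + 1 - y))%:E | u in [set u | (0 <= u)%R]]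
    = +oo.
  move=> k0 h; apply/eqyP => M _.
  apply: le_ereal_sup_tmp.
  exists (- (`|M| / k * p) - ln (y * expR (- (`|M| / k)) + 1 - y))%:E.
    by exists (`|M| / k)%R => //=; rewrite divr_ge0// ltW.
  rewrite lee_fin; apply: le_trans (h _ _); last by rewrite divr_ge0// ltW.
  by rewrite mulrC divfK ?gt_eqF// ler_norm.
have [p0|p0|p0] := ltgtP p 0%R.
- rewrite (@unbounded (- p)%R) ?leey ?oppr_gt0// => u u0.
  rewrite mulNr mulrC lerBrDr gerDl ln_le0//.
  by have := expR_le1 (- u); rewrite oppr_le0 u0; have := expR_gt0 (- u); nra.
(* For [y = 1] the objective is [u (1 - p)]: constantly 0 if [p = 1], unbounded if [p < 1]. For
   [y < 1] both arguments are interior and the supremum is attained. *)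
- have := y1; rewrite (le_eqVlt y) => /predU1P[yE|{}y1].
    have p1 : (p <= 1)%R by exact: le_trans py y1.
    rewrite yE in unbounded *; move: p1; rewrite (le_eqVlt p) => /predU1P[->|p1].
      apply: le_ereal_sup_tmp; eexists; first by exists 0%R => //=.
      rewrite mul0r oppr0 expR0 mulr1 [(1 + 1)%R]addrC addrK ln1 subrr.
      by rewrite /kl ler01 lexx/= /xlogx_div subrr eqxx oner_eq0 divr1 ln1 mulr0 adde0.
    rewrite (@unbounded (1 - p)%R) ?leey ?subr_gt0// => u u0.
    by rewrite mul1r addrK expRK opprK mulrBl mul1r addrC mulrC.
  apply: le_ereal_sup_tmp; eexists; last first.
    by rewrite kl_attained ?p0 ?(le_lt_trans py)// y1 (lt_le_trans p0).
  eexists; last by [].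
  rewrite /= ln_ge0// ler_pdivlMr ?mulr_gt0 ?subr_gt0//; nra.
- have := y1; rewrite (le_eqVlt y) => /predU1P[yE|{}y1].
    rewrite (@unbounded 1%R) ?leey// => u u0.
    by rewrite yE p0 mulr0 oppr0 sub0r !mul1r addrK expRK opprK.
  rewrite p0 /kl lexx ler01/= /xlogx_div eqxx subr0 oner_eq0 subr_eq0 gt_eqF//.
  rewrite add0e mul1r div1r lnV ?posrE ?subr_gt0//.
  apply/lee_addgt0Pr => e e0.
  (* Chosen so that [e * u] equals the odds [y / (1 - y)]. Then [u <= expR u] bounds the excess term
     [y / (1 - y) * expR (- u)] by [e]. *)
  set u := (y / ((1 - y) * e))%R.
  have u0 : (0 <= u)%R by rewrite divr_ge0// mulr_ge0 ?subr_ge0// ltW.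
  rewrite -leeBlDr//; apply: le_ereal_sup_tmp; eexists; first by exists u.
  rewrite -EFinB lee_fin mulr0 oppr0 sub0r.
  suff : (ln (y * expR (- u) + 1 - y) <= ln (1 - y) + e)%R by lra.
  have y'0 : (0 < 1 - y)%R by rewrite subr_gt0.
  have -> : (y * expR (- u) + 1 - y = (1 - y) * (1 + y / (1 - y) * expR (- u)))%R.
    by field; rewrite gt_eqF.
  have k0 : (0 <= y / (1 - y) * expR (- u))%R.
    by rewrite mulr_ge0 ?expR_ge0 ?divr_ge0// ltW.
  rewrite lnM ?posrE ?y'0 ?(ltr_wpDr k0)// lerD2l.
  apply: le_trans (le_ln1Dx _) _; first by move: k0; lra.
  rewrite expRN ler_pdivrMr ?expR_gt0//.
  apply: (@le_trans _ _ (e * u)%R).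
    by rewrite /u le_eqVlt; apply/orP; left; apply/eqP; field; rewrite !gt_eqF.
  rewrite (ler_wpM2l (ltW e0))//.
  by have := expR_ge1Dx u; apply: le_trans; rewrite lerDr.
Qed.

End kl.

(** * Conditional expectation and integral comparison over a sub-sigma-algebra *)

Section sub_sigma_algebra.
Context d (T : measurableType d) (R : realType).
Variables (P : probability T R) (G : set (set T)).
Hypotheses (sG : sigma_algebra setT G) (GM : G `<=` measurable).
Local Open Scope ereal_scope.

Let TG := g_sigma_algebraType G.

Lemma measurable_gE (A : set T) : measurable (A : set TG) = G A.
Proof. by rewrite -[LHS]/(<<s G >> A) sigma_algebra_id. Qed.

Lemma sub_measurableW d' (U : measurableType d') (f : T -> U) :
  sub_measurable G f -> measurable_fun setT f.
Proof.
by move=> mf _ Y mY; apply: GM; rewrite -measurable_gE; exact: mf.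
Qed.

(** The restriction of [P] to [G], placed on the type [TG] whose measurable sets are those of [G]; a
    density with respect to it is then automatically [G]-measurable. *)
Definition trace_measure : set TG -> \bar R := fun A => P A.

Let trace0 : trace_measure set0 = 0. Proof. exact: measure0. Qed.
Let trace_ge0 A : 0 <= trace_measure A. Proof. exact: measure_ge0. Qed.
Let trace_sigma_additive : semi_sigma_additive trace_measure.
Proof.
by move=> F mF tF mUF; apply: measure_semi_sigma_additive => // [i|];
  apply: GM; rewrite -measurable_gE.
Qed.
HB.instance Definition _ := isMeasure.Build _ _ _
  trace_measure trace0 trace_ge0 trace_sigma_additive.
Let trace_fin : fin_num_fun trace_measure.
Proof.
by move=> A mA; rewrite /trace_measure fin_num_measure//;
  apply: GM; rewrite -measurable_gE.
Qed.
HB.instance Definition _ := @Measure_isFinite.Build _ _ _ trace_measure trace_fin.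

(** The restriction is the pushforward of [P] under the identity map from [T] to [TG], so this is a
    change of variables. *)
Lemma trace_measure_integral (A : set T) (f : T -> \bar R) : G A ->
  sub_measurable G f -> (forall w, 0 <= f w) ->
  \int[trace_measure]_(w in A) f w = \int[P]_(w in A) f w.
Proof.
move=> GA mf f0.
have mid : measurable_fun [set: T] (id : T -> TG).
  by move=> _ Y mY; rewrite setTI; apply: GM; rewrite -measurable_gE.
rewrite -[RHS](@ge0_integral_pushforward _ _ _ _ _ _ mid P A f)//.
- by rewrite measurable_gE.
- exact: measurable_funTS.
Qed.

Section density.
Variable f : T -> \bar R.
Hypotheses (mf : measurable_fun setT f) (f0 : forall w, 0 <= f w)
  (foo : \int[P]_w f w < +oo).

Definition trace_density : set TG -> \bar R := fun A => \int[P]_(w in A) f w.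

Let density0 : trace_density set0 = 0. Proof. exact: integral_set0. Qed.
Let density_ge0 A : 0 <= trace_density A. Proof. exact: integral_ge0. Qed.
Let density_sigma_additive : semi_sigma_additive trace_density.
Proof.
move=> F mF tF mUF; rewrite /trace_density ge0_integral_bigcup//; last 2 first.
- by move=> i; apply: GM; rewrite -measurable_gE.
- exact: measurable_funTS.
by apply: is_cvg_ereal_nneg_natsum => i _; exact: integral_ge0.
Qed.
HB.instance Definition _ := isMeasure.Build _ _ _
  trace_density density0 density_ge0 density_sigma_additive.
Let density_fin : fin_num_fun trace_density.
Proof.
move=> A mA; rewrite ge0_fin_numE; last exact: integral_ge0.
apply: le_lt_trans foo; apply: ge0_subset_integral => //.
by apply: GM; rewrite -measurable_gE.
Qed.
HB.instance Definition _ := @Measure_isFinite.Build _ _ _ trace_density density_fin.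

(** Radon-Nikodym on [G]: the conditional expectation is the density of [trace_density] with respect
    to [trace_measure]. *)
Lemma is_cond_exp_ge0_ex : exists g, is_cond_exp_ge0 P G f g.
Proof.
have [|g [g0 ig gE]] := @radon_nikodym_finite _ _ _ trace_measure trace_density.
  apply/null_content_dominatesP => A mA PA0.
  have GA : measurable (A : set T) by apply: GM; rewrite -measurable_gE.
  have := @ge0_negligible_integral _ _ _ P A A f GA GA
    (measurable_funTS mf) (fun w _ => f0 w) PA0.
  by rewrite setDv integral_set0.
exists g; split => //; first exact: measurable_int ig.
move=> A GA; rewrite -trace_measure_integral//; last exact: measurable_int ig.
by rewrite -gE ?measurable_gE.
Qed.

Lemma is_cond_exp_ex : exists g, is_cond_exp P G f g /\ is_cond_exp_ge0 P G f g.
Proof.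
have [g fg] := is_cond_exp_ge0_ex; have [mg g0 gE] := fg.
exists g; split => //; split => //; exists g, (cst 0); split.
- rewrite (_ : f^\+ = f)//; apply/funext => w.
  by rewrite (@ge0_funeposE _ _ setT)// inE.
- rewrite (_ : f^\- = cst 0); last first.
    by apply/funext => w; rewrite (@ge0_funenegE _ _ setT)// inE.
  by split => //; exact: measurable_cst.
- by apply/aeW => w; right; rewrite ltry.
- by apply/aeW => w; rewrite sube0.
Qed.

End density.

(** The set [B] where [u] exceeds [v] belongs to [G]. The integral of [u - v] over it is nonnegative
    by choice of [B] and nonpositive by hypothesis; integrability of [v] permits the subtraction. *)
Lemma sub_ae_le (u : T -> \bar R) (v : T -> R) :
  sub_measurable G u -> sub_measurable G v ->
  (forall w, 0 <= u w) -> (forall w, 0 <= v w)%R -> \int[P]_w (v w)%:E < +oo ->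
  (forall A, G A -> \int[P]_(w in A) u w <= \int[P]_(w in A) (v w)%:E) ->
  {ae P, forall w, u w <= (v w)%:E}.
Proof.
move=> mu mv u0 v0 voo uv.
have mu' := sub_measurableW mu; have mv' : measurable_fun setT (EFin \o v).
  by apply: measurableT_comp => //; exact: sub_measurableW.
pose B : set T := [set w | 0 < u w - (v w)%:E].
have GB : G B.
  rewrite -measurable_gE -[X in measurable X]setTI.
  apply: (@emeasurable_fun_o_infty _ TG R setT (fun w => u w - (v w)%:E) measurableT).
  by apply: emeasurable_funB => //; exact/measurable_EFinP.
have mB : measurable B := GM GB.
have muv : measurable_fun B (fun w => u w - (v w)%:E).
  by apply: measurable_funTS; exact: emeasurable_funB.
have : \int[P]_(w in B) `|u w - (v w)%:E| = 0.
  have vB : \int[P]_(w in B) (v w)%:E \is a fin_num.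
    rewrite ge0_fin_numE; last by apply: integral_ge0 => w _; rewrite lee_fin.
    apply: le_lt_trans voo; apply: ge0_subset_integral => //.
    by move=> w _; rewrite lee_fin.
  rewrite (eq_integral (fun w => u w - (v w)%:E)); last first.
    by move=> w; rewrite inE => /= /ltW/gee0_abs.
  apply/eqP; rewrite eq_le; apply/andP; split; last first.
    by apply: integral_ge0 => w /ltW.
  rewrite -(leeD2rE _ _ vB) add0e -ge0_integralD//; last 3 first.
  - by move=> w /ltW.
  - by move=> w _; rewrite lee_fin.
  - exact: measurable_funTS.
  under eq_integral do rewrite subeK//.
  exact: uv.
move/(ae_eq_integral_abs P mB muv); apply: filterS => w; rewrite /= => h.
rewrite leNgt; apply/negP; rewrite -sube_gt0 => uvw.
by have := h uvw; apply/eqP; rewrite gt_eqF.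
Qed.

(* Monotone approximation of the [G]-measurable weight [h] by simple functions. *)
Lemma sub_integralM_le (h : T -> \bar R) (u v : T -> R) : sub_measurable G h ->
  measurable_fun setT u -> measurable_fun setT v ->
  (forall w, 0 <= h w) -> (forall w, 0 <= u w)%R -> (forall w, 0 <= v w)%R ->
  (forall A, G A -> \int[P]_(w in A) (u w)%:E <= \int[P]_(w in A) (v w)%:E) ->
  \int[P]_w (h w * (u w)%:E) <= \int[P]_w (h w * (v w)%:E).
Proof.
move=> mh mu mv h0 u0 v0 uv.
pose g := nnsfun_approx (measurableT : measurable [set: TG]) mh.
have mg n : measurable_fun [set: T] (fun w : T => (g n w)%:E).
  by apply: sub_measurableW; exact/measurable_EFinP/measurable_funP.
have gh w : EFin \o g ^~ w @ \oo --> h w by exact: cvg_nnsfun_approx.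
have ndg w m n : (m <= n)%N -> (g m w <= g n w)%R.
  by move=> mn; exact/lefP/nd_nnsfun_approx.
have mgk n (k : T -> R) : measurable_fun setT k ->
    measurable_fun setT (fun w : T => (g n w)%:E * (k w)%:E).
  move=> mk.
  apply: (@emeasurable_funM _ T R _ (fun w : T => (g n w)%:E) (fun w => (k w)%:E)).
    exact: mg.
  exact: measurableT_comp.
have E (k : T -> R) : (forall w, 0 <= k w)%R -> measurable_fun setT k ->
    \int[P]_w (h w * (k w)%:E) = limn (fun n => \int[P]_w ((g n w)%:E * (k w)%:E)).
  move=> k0 mk; rewrite -monotone_convergence//.
  - apply: eq_integral => w _; apply/esym/cvg_lim => //.
    by apply: (@cvgeZr _ _ _ (fun n => (g n w)%:E) (h w)) => //; exact: gh.
  - by move=> n; exact: mgk.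
  - by move=> n w _; rewrite mule_ge0// lee_fin.
  - by move=> w _ m n mn; rewrite lee_wpmul2r ?lee_fin// ndg.
have cvgE (k : T -> R) : (forall w, 0 <= k w)%R -> measurable_fun setT k ->
    cvgn (fun n => \int[P]_w ((g n w)%:E * (k w)%:E)).
  move=> k0 mk; apply: ereal_nondecreasing_is_cvgn => m n mn.
  apply: ge0_le_integral => //.
  - by move=> w _; rewrite mule_ge0// lee_fin.
  - exact: mgk.
  - exact: mgk.
  - by move=> w _; rewrite lee_wpmul2r ?lee_fin// ndg.
(* For a simple weight the integral is a finite sum over its level sets. These lie in [G], so the
   hypothesis applies level by level. *)
have gE (k : T -> R) n : (forall w, 0 <= k w)%R -> measurable_fun setT k ->
    \int[P]_w ((g n w)%:E * (k w)%:E) =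
    \sum_(r \in range (g n)) (r%:E * \int[P]_(w in g n @^-1` [set r]) (k w)%:E).
  move=> k0 mk.
  have mgr r : measurable (g n @^-1` [set r] : set T).
    by apply: GM; rewrite -measurable_gE; exact: measurable_sfunP.
  have mr r : measurable_fun setT (fun w : T => (\1_(g n @^-1` [set r]) w)%:E * (k w)%:E).
    apply: (@emeasurable_funM _ T R _ (fun w : T => (\1_(g n @^-1` [set r]) w)%:E)
      (fun w => (k w)%:E)); last exact: measurableT_comp.
    by apply: measurableT_comp => //; exact: measurable_indic.
  under eq_integral => w _.
    rewrite fimfunE -fsumEFin// ge0_mule_fsuml; last first.
      by move=> r; rewrite EFinM nnfun_muleindic_ge0.
    under eq_fsbigr => r _ do rewrite EFinM -muleA.
    over.
  rewrite (@ge0_integral_fsum _ _ _ P setT measurableT _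
      (fun r w => r%:E * ((\1_(g n @^-1` [set r]) w)%:E * (k w)%:E)))//.
  - apply: eq_fsbigr => r; rewrite inE => -[w _ <-].
    rewrite ge0_integralZl ?lee_fin//; last by move=> z _; rewrite mule_ge0// lee_fin.
    congr (_ * _); rewrite [RHS]integral_mkcond; apply: eq_integral => z _.
    by rewrite patchE indicE; case: ifP; rewrite ?mul1e ?mul0e.
  - by move=> r; apply: emeasurable_funM => //; exact: measurable_cst.
  - move=> r w _; rewrite muleA mule_ge0 ?lee_fin//.
    by rewrite -lee_fin EFinM nnfun_muleindic_ge0.
rewrite !E//; apply: lee_lim; [exact: cvgE|exact: cvgE|].
apply: nearW => n; rewrite !gE//; apply: lee_fsum => // r [w _ <-].
rewrite lee_wpmul2l ?lee_fin//; apply: uv.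
by rewrite -measurable_gE; exact: measurable_sfunP.
Qed.

End sub_sigma_algebra.

(** * Measurability of the extended logarithm and exponential *)

Section measurability.
Context {R : realType}.
Local Open Scope ereal_scope.

Lemma measurable_lne : measurable_fun setT (@lne R).
Proof.
move=> mD; apply: (measurability _ (ErealGenCInfty.measurableE R)) => //.
move=> _ [_ [x ->] <-]; rewrite setTI.
rewrite [X in measurable X](_ : _ = `[(expR x)%:E, +oo[%classic).
  exact: emeasurable_itv.
apply/seteqP; split => y /=; rewrite !in_itv/= !andbT.
  case: y => [y| |]//=; rewrite ?leey//.
  case: ifPn => // y0.
  by rewrite -[in X in _ -> X](@lnK _ y) ?lee_fin ?ler_expR// posrE ltNge.
case: y => [y| |]//=; rewrite ?leey//.
rewrite lee_fin => xy; have y0 : (0 < y)%R by rewrite (lt_le_trans _ xy)// expR_gt0.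
by rewrite -[leRHS]/(lne y%:E) lne_EFin// lee_fin -(@expRK _ x) ler_ln ?posrE// expR_gt0.
Qed.

Lemma measurable_expeR : measurable_fun setT (@expeR R).
Proof.
move=> mD; apply: (measurability _ (ErealGenCInfty.measurableE R)) => //.
move=> _ [_ [x ->] <-]; rewrite setTI; have [x0|x0] := leP x 0%R.
  rewrite (_ : _ @^-1` _ = setT)//; apply/seteqP; split => // y _ /=.
  by rewrite in_itv/= andbT (le_trans _ (expeR_ge0 y)) ?lee_fin.
rewrite [X in measurable X](_ : _ = `[(ln x)%:E, +oo[%classic).
  exact: emeasurable_itv.
have xE : x%:E = expeR (ln x)%:E by rewrite /= lnK.
by apply/seteqP; split => y /=; rewrite !in_itv/= !andbT xE lee_expeR.
Qed.
End measurability.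

(** * One time step: the conditional chord bound and clipping to the range *)

Section increment.
Context d (T : measurableType d) (R : realType).
Variables (P : probability T R) (G : set (set T)).
Hypotheses (sG : sigma_algebra setT G) (GM : G `<=` measurable).
Local Open Scope ereal_scope.

(** The one-step situation after clipping. The range bounds hold at every point, and the drift
    inequality is tested on events of [G] instead of being stated through a conditional
    expectation. *)
Record bounded_drift (r : R) (D U : T -> R) := BoundedDrift {
  bd_mD : measurable_fun setT D;
  bd_mU : sub_measurable G U;
  bd_D : forall w, (0 <= D w <= r)%R;
  bd_U : forall w, (0 <= U w <= r)%R;
  bd_drift : forall A, G A ->
    \int[P]_(w in A) (U w)%:E <= \int[P]_(w in A) (D w)%:E }.

Lemma integral_bounded_lty (A : set T) (f : T -> R) (k : R) : measurable A ->
  measurable_fun setT f -> (forall w, 0 <= f w <= k)%R ->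
  \int[P]_(w in A) (f w)%:E < +oo.
Proof.
move=> mA mf fk; apply: (@le_lt_trans _ _ (\int[P]_(w in A) (cst k%:E w))).
  apply: ge0_le_integral => //.
  - by move=> w _; rewrite lee_fin; have /andP[] := fk w.
  - by apply: measurable_funTS; exact: measurableT_comp.
  - by move=> w _; rewrite lee_fin; have /andP[] := fk w.
rewrite integral_cst//= -ge0_fin_numE ?fin_numM// ?fin_num_measure//.
by rewrite mule_ge0// lee_fin; have /andP[f0 fr] := fk point; exact: le_trans fr.
Qed.

Section bounded.
Variables (r : R) (D U : T -> R).
Hypotheses (r0 : (0 < r)%R) (DU : bounded_drift r D U).

(** Affine interpolation of [u -> expR (- (s * u))] between the endpoints 0 and [r]. *)
Definition chord (s u : R) : R := (u / r * expR (- (s * r)) + 1 - u / r)%R.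

Lemma div_range u : (0 <= u <= r)%R -> (0 <= u / r <= 1)%R.
Proof.
by move=> /andP[u0 ur]; rewrite divr_ge0 ?(ltW r0)//= ler_pdivrMr// mul1r.
Qed.

Lemma chord_ge s u : (0 <= u <= r)%R -> (expR (- (s * u)) <= chord s u)%R.
Proof.
move=> /div_range ur; apply: le_trans (expR_chord (s * r) ur).
by rewrite ler_expR lerN2 [leLHS](_ : _ = s * u)%R//; field; rewrite gt_eqF.
Qed.

Lemma chord_le1 s u : (0 <= s)%R -> (0 <= u <= r)%R -> (0 <= chord s u <= 1)%R.
Proof.
move=> s0 ur; rewrite (le_trans _ (chord_ge s ur)) ?expR_ge0//=.
have /andP[y0 _] := div_range ur.
have e1 : (expR (- (s * r)) <= 1)%R by rewrite expR_le1 oppr_le0 mulr_ge0// ltW.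
by rewrite /chord; nra.
Qed.

Lemma measurable_chord d' (T' : measurableType d') s (f : T' -> R) :
  measurable_fun setT f -> measurable_fun setT (chord s \o f).
Proof.
move=> mf; rewrite /chord /comp; apply: measurable_funB; last exact: measurable_funM.
by apply: measurable_funD => //; apply: measurable_funM => //; exact: measurable_funM.
Qed.

Let mU : measurable_fun setT U. Proof. exact: (sub_measurableW sG GM (bd_mU DU)). Qed.

(** Convexity passes from the exponential to the chord at [D]. The chord is affine with slope
    [- k <= 0], so the drift inequality lets [U] replace [D]. *)
Lemma integral_chord s (A : set T) : (0 <= s)%R -> G A ->
  \int[P]_(w in A) (expR (- (s * D w)))%:E <= \int[P]_(w in A) (chord s (U w))%:E.
Proof.
move=> s0 GA; have mA := GM GA; have mD := bd_mD DU.
have mDA (f : R -> R) : measurable_fun setT f -> measurable_fun A (fun w => (f (D w))%:E).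
  by move=> mf; apply/measurable_funTS/measurable_EFinP; exact: measurableT_comp mf mD.
have mUA (f : R -> R) : measurable_fun setT f -> measurable_fun A (fun w => (f (U w))%:E).
  by move=> mf; apply/measurable_funTS/measurable_EFinP; exact: measurableT_comp mf mU.
have mc : measurable_fun setT (chord s) by exact: (@measurable_chord _ _ s id).
pose k := ((1 - expR (- (s * r))) / r)%R.
have k0 : (0 <= k)%R.
  by rewrite divr_ge0 ?(ltW r0)// subr_ge0 expR_le1 oppr_le0 mulr_ge0// ltW.
have cE u : (1 = chord s u + k * u)%R.
  by rewrite /chord /k; field; rewrite gt_eqF.
have mk : measurable_fun setT (fun u : R => k * u)%R by exact: measurable_funM.
apply: (@le_trans _ _ (\int[P]_(w in A) (chord s (D w))%:E)).
  apply: ge0_le_integral => //.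
  - apply: (mDA (fun u : R => expR (- (s * u)))); apply: measurableT_comp => //.
    by apply: measurableT_comp => //; exact: measurable_funM.
  - exact: (mDA (chord s) mc).
  - by move=> w _; rewrite lee_fin chord_ge// (bd_D DU).
(* The identity [1 = chord s u + k * u], integrated for [V = D] and for [V = U], compares the chord
   integrals through sums of nonnegative terms. *)
have E (V : T -> R) : measurable_fun setT V -> (forall w, 0 <= V w <= r)%R ->
    P A = \int[P]_(w in A) (chord s (V w))%:E + k%:E * \int[P]_(w in A) (V w)%:E.
  move=> mV Vr; have mVA : measurable_fun A (EFin \o V).
    by apply: measurable_funTS; exact/measurable_EFinP.
  rewrite -ge0_integralZl//; last by move=> w _; rewrite lee_fin; have /andP[] := Vr w.
  rewrite -ge0_integralD//.
  - rewrite -(mul1e (P A)) -integral_cst//; apply: eq_integral => w _.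
    by rewrite -EFinM -EFinD -cE.
  - by move=> w _; rewrite lee_fin; have /andP[] := chord_le1 s0 (Vr w).
  - by apply/measurable_funTS/measurable_EFinP; exact: measurableT_comp mc mV.
  - by move=> w _; rewrite -EFinM lee_fin mulr_ge0//; have /andP[] := Vr w.
  - by apply: emeasurable_funM => //; exact: measurable_cst.
have fU : k%:E * \int[P]_(w in A) (U w)%:E \is a fin_num.
  rewrite fin_numM// ge0_fin_numE; first exact: integral_bounded_lty (bd_U DU).
  by apply: integral_ge0 => w _; rewrite lee_fin; have /andP[] := bd_U DU w.
rewrite -(leeD2rE _ _ fU) -E//; last exact: bd_U DU.
rewrite (E D)//; last exact: bd_D DU.
by rewrite leeD2l// lee_wpmul2l ?lee_fin//; exact: bd_drift DU _ GA.
Qed.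

Lemma integralM_chord (h : T -> \bar R) s : (0 <= s)%R ->
  sub_measurable G h -> (forall w, 0 <= h w) ->
  \int[P]_w (h w * (expR (- (s * D w)))%:E) <= \int[P]_w (h w * (chord s (U w))%:E).
Proof.
move=> s0 mh h0; apply: (sub_integralM_le sG GM) => //.
- apply: measurableT_comp => //; apply: measurableT_comp => //.
  by apply: measurable_funM => //; exact: bd_mD DU.
- exact: measurable_chord.
- by move=> w; have /andP[] := chord_le1 s0 (bd_U DU w).
- by move=> A GA; exact: integral_chord.
Qed.

Lemma chord_hoeffding s u : (0 <= s)%R -> (0 <= u <= r)%R ->
  (expR (s * u) * chord s u <= expR (r ^+ 2 * s ^+ 2 / 8))%R.
Proof.
move=> s0 ur; have y01 := div_range ur.
have h := hoeffding_two_point y01 (mulr_ge0 s0 (ltW r0)).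
rewrite -/(chord s u) -ler_expR expRD lnK in h; last by rewrite posrE two_point_gt0.
rewrite (_ : u / r * (s * r) = s * u)%R in h; last by field; rewrite gt_eqF.
by apply: le_trans h _; rewrite ler_expR exprMn [(s ^+ 2 * _)%R]mulrC.
Qed.

(** Both sides are compared on each event [A] of [G]: the weight [1_A exp(s U)] is [G]-measurable,
    so [integralM_chord] applies to it. *)
Lemma cond_exp_le_chord s (g : T -> \bar R) : (0 <= s)%R ->
  is_cond_exp_ge0 P G (fun w => (expR (s * U w) * expR (- (s * D w)))%:E) g ->
  {ae P, forall w, g w <= (expR (s * U w) * chord s (U w))%:E}.
Proof.
move=> s0 [mg g0 gE].
have mexp : measurable_fun setT (fun u : R => expR (s * u)).
  by apply: measurableT_comp => //; exact: measurable_funM.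
have mv : measurable_fun setT (fun u : R => expR (s * u) * chord s u)%R.
  by apply: measurable_funM => //; exact: (@measurable_chord _ _ s id).
have sE : sub_measurable G (fun w => expR (s * U w)) := measurableT_comp mexp (bd_mU DU).
have sv : sub_measurable G (fun w => expR (s * U w) * chord s (U w))%R :=
  measurableT_comp mv (bd_mU DU).
have v0 w : (0 <= expR (s * U w) * chord s (U w) <= expR (s * r))%R.
  have /andP[c0 c1] := chord_le1 s0 (bd_U DU w); have /andP[_ Ur] := bd_U DU w.
  rewrite mulr_ge0 ?expR_ge0//= -[leRHS]mulr1 ler_pM ?expR_ge0//.
  by rewrite ler_expR ler_wpM2l.
apply: (sub_ae_le sG GM) => //.
- by move=> w; have /andP[] := v0 w.
- by apply: integral_bounded_lty v0 => //; exact: (sub_measurableW sG GM).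
move=> A GA; rewrite gE//.
have GE : sub_measurable G (fun w => (\1_A w * expR (s * U w))%:E).
  apply/measurable_EFinP; apply: measurable_funM => //.
  by apply: measurable_indic; rewrite measurable_gE.
have := @integralM_chord (fun w => (\1_A w * expR (s * U w))%:E) s s0 GE.
have E (k : T -> R) : \int[P]_w ((\1_A w * expR (s * U w))%:E * (k w)%:E) =
    \int[P]_(w in A) (expR (s * U w) * k w)%:E.
  rewrite [RHS]integral_mkcond; apply: eq_integral => w _.
  by rewrite patchE indicE; case: ifP => _; rewrite -EFinM ?mul1r ?mul0r.
by rewrite !E; apply => w; rewrite lee_fin mulr_ge0 ?expR_ge0.
Qed.

End bounded.

(** Projection onto [[0, r]]; it turns almost sure bounds into bounds at every point. *)
Definition clip (r x : R) : R := Num.max 0%R (Num.min r x).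

Lemma clip_range r x : (0 <= r)%R -> (0 <= clip r x <= r)%R.
Proof. by move=> r0; rewrite /clip le_max lexx/= ge_max r0 ge_min lexx. Qed.

Lemma clip_id r x : (0 <= x <= r)%R -> clip r x = x.
Proof. by move=> /andP[x0 xr]; rewrite /clip (min_idPr xr) (max_idPr x0). Qed.

Lemma measurable_clip r : measurable_fun setT (clip r).
Proof. by apply: measurable_maxr => //; apply: measurable_minr. Qed.

Section drift.
Variables (lo up : R) (L : T -> \bar R) (c : T -> R) (g : T -> \bar R).
Hypotheses (lu : (lo < up)%R) (mL : measurable_fun setT L)
  (mc : sub_measurable G c) (Lg : is_cond_exp P G L g)
  (cg : {ae P, forall w, (c w)%:E <= g w})
  (Lb : {ae P, forall w, lo%:E <= L w <= up%:E})
  (c0 : {ae P, forall w, (0 <= c w - lo)%R}).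

Let r : R := (up - lo)%R.
Let r0 : (0 < r)%R. Proof. by rewrite subr_gt0. Qed.

(** [fine] sends infinite values of [L w] to 0; by [Lb] they occur only on a null set. *)
Definition incr (w : T) : R := clip r (fine (L w) - lo).
Definition drift (w : T) : R := clip r (c w - lo).

Let D := incr.
(** Clipped from below only: the upper bound [c w - lo <= r] is a consequence of the drift
    inequality, derived in [driftE]. *)
Let U0 (w : T) : R := Num.max 0%R (c w - lo)%R.

Let mD : measurable_fun setT D.
Proof.
apply: measurableT_comp; first exact: measurable_clip.
by apply: measurable_funB => //; apply: measurableT_comp => //; exact: fine_measurable.
Qed.

Let mU0 : sub_measurable G U0.
Proof. by apply: measurable_maxr => //; apply: measurable_funB. Qed.

Lemma incrE : {ae P, forall w, L w = (lo + incr w)%:E}.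
Proof.
apply: filterS Lb => w; rewrite /incr.
case: (L w) => [x|/andP[_]|/andP[]]; rewrite ?leye_eq ?leeNy_eq//=.
rewrite !lee_fin => /andP[lx xu]; rewrite clip_id.
  by rewrite addrC subrK.
by rewrite subr_ge0 lx/= lerD2r.
Qed.

(** The certificate [c <= gp - gm] is rearranged into an inequality between sums of nonnegative
    functions. The integrals of [gp] and [gm] over [A] are then replaced by those of [L^\+] and
    [L^\-], and the common part cancels. *)
Lemma integral_drift (A : set T) : G A ->
  \int[P]_(w in A) (U0 w)%:E <= \int[P]_(w in A) (D w)%:E.
Proof.
move=> GA; have mA := GM GA.
have [mg [gp [gm [[mgp gp0 gpE] [mgm gm0 gmE] gfin gE]]]] := Lg.
(* Positive and negative parts of [lo]; inside this proof the name [ln] shadows the logarithm. *)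
pose lp : R := Num.max lo 0%R; pose ln : R := Num.max (- lo)%R 0%R.
have lp0 : (0 <= lp)%R by rewrite le_max lexx orbT.
have ln0 : (0 <= ln)%R by rewrite le_max lexx orbT.
have lpn : (lp - ln = lo)%R.
  rewrite /lp /ln; case/orP: (le_total 0%R lo) => l0.
    by rewrite (max_idPl l0) (max_idPr _) ?oppr_le0// subr0.
  by rewrite (max_idPr l0) (max_idPl _) ?oppr_ge0// opprK add0r.
have mcst (k : R) : measurable_fun A (fun _ : T => k%:E) by exact: measurable_cst.
have mU0A : measurable_fun A (EFin \o U0).
  by apply/measurable_funTS/measurable_EFinP; exact: (sub_measurableW sG GM).
have mDA : measurable_fun A (EFin \o D).
  by apply/measurable_funTS/measurable_EFinP.
have mgmA : measurable_fun A gm.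
  by apply: measurable_funTS; exact: (sub_measurableW sG GM).
have mgpA : measurable_fun A gp.
  by apply: measurable_funTS; exact: (sub_measurableW sG GM).
have mLn : measurable_fun A L^\- by apply: measurable_funTS; exact: measurable_funeneg.
have mLp : measurable_fun A L^\+ by apply: measurable_funTS; exact: measurable_funepos.
have U00 w : (0 <= U0 w)%R by rewrite le_max lexx.
have D0 w : (0 <= D w)%R by have /andP[] := clip_range (fine (L w) - lo) (ltW r0).
have key : \int[P]_(w in A) ((U0 w)%:E + (gm w + lp%:E)) <=
           \int[P]_(w in A) (gp w + ln%:E).
  apply: ae_ge0_le_integral => //.
  - by move=> w _; rewrite !adde_ge0 ?lee_fin.
  - by apply: emeasurable_funD => //; apply: emeasurable_funD.
  - by move=> w _; rewrite adde_ge0 ?lee_fin.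
  - by apply: emeasurable_funD.
  apply: filterS3 cg c0 gE => /= w cgw c0w gw _; rewrite {}gw in cgw.
  have -> : U0 w = (c w - lo)%R by exact/max_idPr.
  move: cgw (gp0 w) (gm0 w).
  case: (gp w) => [a| |]; case: (gm w) => [b| |]; rewrite ?leeNy_eq ?addye ?leey//.
  by rewrite -EFinB !lee_fin => *; lra.
have key2 : \int[P]_(w in A) (L^\+ w + ln%:E) =
    \int[P]_(w in A) ((D w)%:E + (L^\- w + lp%:E)).
  apply: ge0_ae_eq_integral => //.
  - by apply: emeasurable_funD.
  - by apply: emeasurable_funD => //; apply: emeasurable_funD.
  - by move=> w _; rewrite adde_ge0 ?lee_fin.
  - by move=> w _; rewrite !adde_ge0 ?lee_fin.
  apply: filterS incrE => /= w LE _.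
  rewrite funeposE funenegE LE -EFinN -!EFin_max -!EFinD; congr _%:E.
  rewrite -/(D w); have := D0 w.
  case/orP: (le_total 0%R (lo + D w)%R) => h.
    rewrite (max_idPl h) (max_idPr _) ?oppr_le0//; lra.
  rewrite (max_idPr h) (max_idPl _) ?oppr_ge0//; lra.
have ID (f1 f2 : T -> \bar R) : (forall w, 0 <= f1 w) -> (forall w, 0 <= f2 w) ->
    measurable_fun A f1 -> measurable_fun A f2 ->
    \int[P]_(w in A) (f1 w + f2 w) = \int[P]_(w in A) f1 w + \int[P]_(w in A) f2 w.
  by move=> f10 f20 mf1 mf2; rewrite ge0_integralD.
rewrite !ID// in key key2;
  do 1?[by move=> w; rewrite adde_ge0 ?lee_fin | exact: emeasurable_funD].
rewrite gmE// gpE// key2 in key.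
(* The cancelled term is finite because [L^\-] is at most [|lo|] almost surely. *)
rewrite leeD2rE// in key.
have fc (k : R) : (0 <= k)%R -> \int[P]_(w in A) k%:E \is a fin_num.
  by move=> k0; rewrite integral_cst// fin_numM// fin_num_measure.
rewrite fin_numD fc// andbT ge0_fin_numE; last exact: integral_ge0.
apply: (@le_lt_trans _ _ (\int[P]_(w in A) `|lo|%:E)); last first.
  by rewrite -ge0_fin_numE ?fc// integral_ge0.
apply: ae_ge0_le_integral => //.
apply: filterS incrE => w /= LE _; rewrite funenegE LE -EFinN -EFin_max lee_fin.
have := D0 w; rewrite -/(D w) => Dw; rewrite ge_max normr_ge0 andbT.
by rewrite -normrN (le_trans _ (ler_norm _))// lerN2 lerDl.
Qed.

(** Clipping from above only lowers the drift, so the inequality for [U0] passes to [drift]. *)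
Lemma bounded_drift_clip : bounded_drift r incr drift.
Proof.
have ms : sub_measurable G drift.
  by apply: measurableT_comp; [exact: measurable_clip|exact: measurable_funB].
split => // [w|w|A GA]; [exact: clip_range (ltW r0)|exact: clip_range (ltW r0)|].
apply: le_trans (integral_drift GA); have mA := GM GA; apply: ge0_le_integral => //.
- by move=> w _; rewrite lee_fin; have /andP[] := clip_range (c w - lo) (ltW r0).
- by apply/measurable_funTS/measurable_EFinP; exact: (sub_measurableW sG GM).
- by apply/measurable_funTS/measurable_EFinP; exact: (sub_measurableW sG GM).
- move=> w _; rewrite lee_fin /drift /clip /U0 ge_max !le_max lexx/=.
  by rewrite !ge_min lexx !orbT.
Qed.

(** On every event of [G] the integral of [U0] is at most that of [D <= r], so [U0 <= r] almost
    surely by [sub_ae_le]; clipping therefore changes [c - lo] only on a null set. *)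
Lemma driftE : {ae P, forall w, (0 <= c w - lo <= r)%R /\ c w = (lo + drift w)%R}.
Proof.
have : {ae P, forall w, (U0 w)%:E <= (cst r w)%:E}.
  apply: (sub_ae_le sG GM (v := cst r)) => //.
  - exact: measurableT_comp.
  - exact: measurable_cst.
  - by move=> w; rewrite lee_fin le_max lexx.
  - by move=> w; exact: ltW.
  - by apply: (@integral_bounded_lty _ _ r) => // w; rewrite lexx ltW.
  move=> A GA; apply: le_trans (integral_drift GA) _; have mA := GM GA.
  apply: ge0_le_integral => //.
  - by move=> w _; rewrite lee_fin; have /andP[] := clip_range (fine (L w) - lo) (ltW r0).
  - by apply/measurable_funTS/measurable_EFinP.
  - exact: (measurable_cst r%:E).
  - by move=> w _; rewrite lee_fin; have /andP[] := clip_range (fine (L w) - lo) (ltW r0).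
apply: filterS2 c0 => w c0w; rewrite lee_fin /U0 ge_max => /andP[_ cr].
by rewrite c0w cr /drift clip_id ?c0w// addrC subrK.
Qed.

End drift.
End increment.

(** * Iteration over time, the Chernoff bound and the stopping time *)

Section process.
Context d (T : measurableType d) (R : realType).
Variables (P : probability T R) (F : nat -> set (set T)).
Hypothesis hF : filtration F.
Local Open Scope ereal_scope.

Lemma sub_measurable_le m n d' (U : measurableType d') (f : T -> U) : (m <= n)%N ->
  sub_measurable (F m) f -> sub_measurable (F n) f.
Proof.
have [sF _ F_mono _] := hF; move=> mn mf _ Y mY.
by rewrite (measurable_gE (sF n)); apply: F_mono mn _ _;
  rewrite -(measurable_gE (sF m)); exact: mf.
Qed.

Lemma sub_measurable_sum s n (f : nat -> T -> R) :
  (forall k, (0 < k <= n)%N -> sub_measurable (F s) (f k)) ->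
  sub_measurable (F s) (fun w => \sum_(1 <= k < n.+1) f k w)%R.
Proof.
elim: n => [|n IH] mf.
  by under eq_fun do rewrite big_geq//; exact: measurable_cst.
under eq_fun do rewrite big_nat_recr//=.
apply: measurable_funD; last by apply: mf; rewrite ltnS leqnn.
by apply: IH => k /andP[k0 kn]; apply: mf; rewrite k0 ltnW.
Qed.

Section tilt.
Variables (r lo : nat -> R) (D U : nat -> T -> R) (t : nat).
Hypotheses (r0 : forall n, (0 < n <= t)%N -> (0 < r n)%R)
  (DU : forall n, (0 < n <= t)%N -> bounded_drift P (F n.-1) (r n) (D n) (U n))
  (mD : forall n, (0 < n <= t)%N -> sub_measurable (F n) (D n)).
Variables (s : R) (B : nat -> R).
Hypotheses (s0 : (0 <= s)%R) (hB : forall n, (0 < n <= t)%N -> forall w,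
  (expR (s * U n w) * chord (r n) s (U n w) <= expR (B n))%R).

Let S n w := (\sum_(1 <= k < n.+1) (U k w - D k w))%R.

Let mS n m : (n <= t)%N -> (n <= m)%N -> sub_measurable (F m) (S n).
Proof.
move=> nt nm; apply: sub_measurable_sum => k /andP[k0 kn].
have k0t : (0 < k <= t)%N by rewrite k0 (leq_trans kn).
have km := leq_trans kn nm.
apply: measurable_funB; last exact: sub_measurable_le km (mD k0t).
by apply: sub_measurable_le (bd_mU (DU k0t)); rewrite (leq_trans (leq_pred k)).
Qed.

(** Induction on time: all of the last factor except [expR (- (s * D n.+1))] is [F n]-measurable, so
    the one-step chord bound applies with the past as weight. The deterministic exponents [B] stay
    abstract to serve both the quadratic and the entropy form. *)
Lemma expected_tilt n : (n <= t)%N ->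
  \int[P]_w (expR (s * S n w))%:E <= (expR (\sum_(1 <= k < n.+1) B k))%:E.
Proof.
have [sF FM _ _] := hF.
elim: n => [_|n IH nt].
  under eq_integral do rewrite /S big_geq// mulr0 expR0.
  rewrite integral_cst// mul1e big_geq// expR0; exact: probability_le1.
have n0t : (0 < n.+1 <= t)%N by [].
have mh : sub_measurable (F n) (fun w => (expR (s * S n w + s * U n.+1 w))%:E).
  apply/measurable_EFinP; apply: measurableT_comp => //; apply: measurable_funD.
    by apply: measurable_funM => //; apply: mS => //; exact: ltnW.
  by apply: measurable_funM => //; exact: (bd_mU (DU n0t)).
have mSn : measurable_fun setT (fun w => (expR (s * S n w))%:E).
  apply/measurable_EFinP; apply: measurableT_comp => //; apply: measurable_funM => //.
  by apply: (sub_measurableW (sF n) (FM n)); apply: mS => //; exact: ltnW.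
rewrite (eq_integral (fun w => (expR (s * S n w + s * U n.+1 w))%:E *
    (expR (- (s * D n.+1 w)))%:E)); last first.
  by move=> w _; rewrite /S big_nat_recr//= -EFinM -expRD; congr (expR _)%:E; ring.
apply: le_trans (integralM_chord (sF n) (FM n) (r0 n0t) (DU n0t) s0 mh _) _.
  by move=> w; rewrite lee_fin expR_ge0.
apply: (@le_trans _ _ (\int[P]_w ((expR (B n.+1))%:E * (expR (s * S n w))%:E))).
  apply: ge0_le_integral => //.
  - move=> w _; rewrite -EFinM lee_fin mulr_ge0 ?expR_ge0//.
    by have /andP[] := chord_le1 (r0 n0t) s0 (bd_U (DU n0t) w).
  - apply: emeasurable_funM.
      exact: (sub_measurableW (sF n) (FM n)).
    apply/measurable_EFinP; apply: measurable_chord.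
    exact: (sub_measurableW (sF n) (FM n) (bd_mU (DU n0t))).
  - by apply: emeasurable_funM => //; exact: measurable_cst.
  - move=> w _; rewrite -!EFinM lee_fin expRD -mulrA mulrC ler_wpM2r ?expR_ge0//.
    exact: hB.
rewrite ge0_integralZl//.
rewrite big_nat_recr//= expRD EFinM muleC lee_wpmul2r ?lee_fin ?expR_ge0//.
exact: IH (ltnW nt).
Qed.

Variables (E : nat -> T -> \bar R) (C alpha : R).
Hypotheses (E0 : forall n, (0 < n)%N -> forall w, 0 <= E n w)
  (mE : forall n, (0 < n)%N -> measurable_fun setT (E n))
  (ED : forall n, (0 < n <= t)%N -> {ae P, forall w, logE E n w = (lo n + D n w)%:E})
  (hC : {ae P, forall w, (C <= \sum_(1 <= n < t.+1) (lo n + U n w))%R})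
  (alpha0 : (0 < alpha)%R).

Lemma measurable_wealth n : measurable_fun setT (wealth E n).
Proof.
elim: n => [|n IH].
  rewrite (_ : wealth E 0 = cst 1); first exact: measurable_cst.
  by apply/funext => w; rewrite /wealth big_geq.
rewrite (_ : wealth E n.+1 = fun w => wealth E n w * E n.+1 w); last first.
  by apply/funext => w; rewrite /wealth big_nat_recr.
by apply: emeasurable_funM => //; exact: mE.
Qed.

Lemma measurable_wealth_le n (x : \bar R) : measurable [set w | wealth E n w <= x].
Proof.
rewrite -[X in measurable X]setTI.
exact: (emeasurable_fun_infty_c measurableT (measurable_wealth n)).
Qed.

Lemma wealthE : {ae P, forall w,
  wealth E t w = (expR (\sum_(1 <= n < t.+1) (lo n + D n w)))%:E}.
Proof.
have : {ae P, forall w n, (0 < n <= t)%N -> logE E n w = (lo n + D n w)%:E}.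
  apply/ae_foralln => n; have [nt|nt] := boolP (0 < n <= t)%N; last exact/aeW.
  by apply: filterS (ED nt).
apply: filterS => w h; rewrite /wealth expR_sum -prodEFin !big_seq; apply: eq_bigr => n.
rewrite mem_index_iota ltnS => nt; have /andP[n0 _] := nt.
by rewrite -[LHS]lneK ?in_itv/= ?E0 ?leey//; move: (h n nt); rewrite /logE => ->.
Qed.

(** On the type-II event the sum of [lo + D] is at most [ln alpha^-1], while that of [lo + U] is at
    least [C]. The lower endpoints cancel, so [S t >= C - ln alpha^-1] there, and Markov's
    inequality applies to [expR (s * S t w)]. *)
Lemma type2_chernoff : type2 P E alpha t <=
  (expR (\sum_(1 <= n < t.+1) B n - s * (C - ln alpha^-1)))%:E.
Proof.
set A := [set w | wealth E t w <= (alpha^-1)%:E].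
have mA : measurable A by exact: measurable_wealth_le.
have [sF FM _ _] := hF.
have mM : measurable_fun setT (fun w => (expR (s * S t w))%:E).
  apply/measurable_EFinP; apply: measurableT_comp => //; apply: measurable_funM => //.
  by apply: (sub_measurableW (sF t) (FM t)); apply: mS.
rewrite expRB EFinM -[(expR _)^-1%R]expRN muleC.
rewrite -(@lee_pmul2l _ (expR (s * (C - ln alpha^-1)))%:E) ?lte_fin ?expR_gt0//.
rewrite muleA -EFinM expRxMexpNx_1 mul1r -integral_cst//.
apply: le_trans (expected_tilt (leqnn t)).
apply: (@le_trans _ _ (\int[P]_(w in A) (expR (s * S t w))%:E)); last first.
  by apply: ge0_subset_integral => // w _; rewrite lee_fin expR_ge0.
apply: ae_ge0_le_integral => //.
- by move=> w _; rewrite lee_fin expR_ge0.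
- exact: measurable_funTS.
apply: filterS2 wealthE hC => w WE Cw; rewrite /A/= WE lee_fin => Wle.
rewrite lee_fin ler_expR ler_wpM2l// /S big_split sumrN/=.
have : (\sum_(1 <= n < t.+1) (lo n + D n w) <= ln alpha^-1)%R.
  by rewrite -ler_expR lnK ?posrE ?invr_gt0.
by move: Cw; rewrite !big_split/=; lra.
Qed.

(** When [C] is below the threshold the excess is 0 and the bound is at least 1: each [B n] is
    nonnegative, since [expR (s * U)] times the chord is at least 1. *)
Lemma type2_excess : type2 P E alpha t <=
  (expR (\sum_(1 <= n < t.+1) B n - s * excess alpha C))%:E.
Proof.
rewrite /excess; case/orP: (le_total 0%R (C - ln alpha^-1)%R) => h.
  by rewrite (max_idPl h); exact: type2_chernoff.
rewrite (max_idPr h) mulr0 subr0 (@le_trans _ _ 1)//.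
  exact/probability_le1/measurable_wealth_le.
rewrite lee_fin -expR0 ler_expR big_seq; apply: sumr_ge0 => n.
rewrite mem_index_iota ltnS => nt; rewrite -ler_expR expR0.
apply: le_trans (hB nt point).
by rewrite -(expRxMexpNx_1 (s * U n point)) ler_wpM2l ?expR_ge0//
  chord_ge ?r0// (bd_U (DU nt)).
Qed.

(** Not having stopped by time [t] means that the wealth stays at or below the threshold at all
    times [1, ..., t], in particular at [t]. *)
Lemma type2_seq_le : (0 < t)%N -> type2_seq P E alpha t <= type2 P E alpha t.
Proof.
move=> t0; have tauE w : (t%:R%:E < tau E alpha w) <->
    (forall n, (0 < n <= t)%N -> wealth E n w <= (alpha^-1)%:E).
  split.
    move=> tw n /andP[n0 nt]; rewrite leNgt; apply/negP => Wn.
    have : tau E alpha w <= n%:R%:E by apply: ereal_inf_lbound; exists n.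
    by move=> /(lt_le_trans tw); rewrite lte_fin ltr_nat ltnNge nt.
  (* Every crossing time is an integer beyond [t], hence at least [t + 1]; this keeps the inequality
     strict in the infimum. *)
  move=> h; apply: (@lt_le_trans _ _ t.+1%:R%:E); first by rewrite lte_fin ltr_nat.
  apply: le_ereal_inf_tmp => _ [n [n0 Wn] <-]; rewrite lee_fin ler_nat ltnNge.
  by apply/negP => nt; move: Wn; rewrite ltNge h ?n0.
rewrite /type2_seq; set A := (X in P X <= _).
have AE : A = \bigcap_(n in [set n | (0 < n <= t)%N])
    [set w | wealth E n w <= (alpha^-1)%:E].
  by apply/seteqP; split => w /=; rewrite /A/= => /tauE.
have mA : measurable A.
  by rewrite AE; apply: bigcap_measurableType => n _; exact: measurable_wealth_le.
apply: le_measure; rewrite ?inE//; first exact: measurable_wealth_le.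
by rewrite AE => w /(_ t); apply; rewrite /= leqnn andbT.
Qed.

End tilt.
End process.

(** * The exact and quadratic majorants of the anchored cumulant generating function *)

Section majorant.
Context d (T : measurableType d) (R : realType).
Variables (lo up : nat -> R) (c : nat -> T -> R) (n : nat).
Hypothesis lu : lo n < up n.
Local Notation r := (log_range lo up n).

Let r0 : 0 < r. Proof. by rewrite subr_gt0. Qed.

Lemma position01 w : (0 <= position lo up c n w <= 1) = (0 <= gap lo c n w <= r).
Proof. by rewrite /position ler_pdivrMr// mul1r pmulr_lge0// invr_gt0. Qed.

Lemma psi_exactE s w : 0 <= gap lo c n w <= r ->
  psi_exact lo up c n s w = (s * gap lo c n w + ln (chord r s (gap lo c n w)))%:E.
Proof. by rewrite -position01 /psi_exact => ->. Qed.

Lemma chord_gt0 s u : 0 <= u <= r -> 0 < chord r s u.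
Proof. by move=> /(chord_ge r0 s); apply: lt_le_trans; exact: expR_gt0. Qed.

Lemma psi_exact_ge0 s w : (0 <= psi_exact lo up c n s w)%E.
Proof.
have [y01|y01] := boolP (0 <= position lo up c n w <= 1); last first.
  by rewrite /psi_exact (negbTE y01).
rewrite position01 in y01; rewrite psi_exactE// lee_fin.
rewrite -ler_expR expR0 expRD lnK ?posrE ?chord_gt0//.
by rewrite -(expRxMexpNx_1 (s * gap lo c n w)) ler_wpM2l ?expR_ge0// chord_ge.
Qed.

Lemma psi_exact_le_quad s w : 0 <= s ->
  (psi_exact lo up c n s w <= psi_quad lo up n s w)%E.
Proof.
move=> s0; have [y01|y01] := boolP (0 <= position lo up c n w <= 1); last first.
  by rewrite /psi_exact (negbTE y01) lee_fin divr_ge0// mulr_ge0 ?sqr_ge0.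
rewrite position01 in y01; rewrite psi_exactE// lee_fin.
by rewrite -ler_expR expRD lnK ?posrE ?chord_gt0// chord_hoeffding.
Qed.

Lemma measurable_psi_exact (G : set (set T)) s : sub_measurable G (c n) ->
  sub_measurable G (psi_exact lo up c n s).
Proof.
move=> mc; have mg : sub_measurable G (gap lo c n) by apply: measurable_funB.
have mp : sub_measurable G (position lo up c n) by apply: measurable_funM.
apply: measurable_fun_ifT => //.
  apply: measurable_and; apply: measurable_fun_ler => //; exact: measurable_cst.
apply/measurable_EFinP; apply: measurable_funD; first exact: measurable_funM.
apply: measurableT_comp; first exact: measurable_ln.
exact: measurable_chord mg.
Qed.

(** As [c] sits at position [y], the endpoints lie at [r - y r] and [- y r] relative to it, and the
    factor [expR (s * (y * r))] comes out of both terms. *)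
Lemma psi_exact_bernoulli s w : 0 <= s -> 0 <= position lo up c n w <= 1 ->
  psi_exact lo up c n s w =
  lne (\int[bernoulli_prob (position lo up c n w)]_b
    (expR (- (s * ((if b then up n else lo n) - c n w))))%:E)%E.
Proof.
move=> s0 y01; rewrite integral_bernoulli_prob//.
rewrite psi_exactE -?position01//; set y := position lo up c n w in y01 *.
have yE : gap lo c n w = y * r by rewrite /y /position divfK// gt_eqF.
have y1 : gap lo c n w / r = y by [].
rewrite /chord y1 yE -[X in (_ + X * _)%E]/((1 - y)%:E) -!EFinM -EFinD.
have -> : y * expR (- (s * (up n - c n w))) + (1 - y) * expR (- (s * (lo n - c n w))) =
    expR (s * (y * r)) * (y * expR (- (s * r)) + 1 - y).
  have -> : - (s * (up n - c n w)) = s * (y * r) + - (s * r).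
    by rewrite -yE /gap /log_range; ring.
  have -> : - (s * (lo n - c n w)) = s * (y * r) by rewrite -yE /gap; ring.
  by rewrite expRD; ring.
rewrite lne_EFin ?mulr_gt0 ?expR_gt0 ?two_point_gt0//.
by rewrite lnM ?posrE ?expR_gt0 ?two_point_gt0// expRK.
Qed.

Section cgf.
Variables (P : probability T R) (F : nat -> set (set T)) (E : nat -> T -> \bar R).
Hypothesis hF : filtration F.
Local Notation G := (F n.-1).
Hypotheses (mE : measurable_fun setT (E n)) (mc : sub_measurable G (c n)).
Variable g0 : T -> \bar R.
Hypotheses (Lg : is_cond_exp P G (logE E n) g0)
  (cg : {ae P, forall w, ((c n w)%:E <= g0 w)%E})
  (Lb : {ae P, forall w, ((lo n)%:E <= logE E n w <= (up n)%:E)%E})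
  (c0 : {ae P, forall w, 0 <= c n w - lo n}).

Let sG : sigma_algebra setT G. Proof. by have [sF _ _ _] := hF; exact: sF. Qed.
Let GM : G `<=` measurable. Proof. by have [_ FM _ _] := hF; exact: FM. Qed.
Let mL : measurable_fun setT (logE E n).
Proof. by apply: measurableT_comp mE; exact: measurable_lne. Qed.

Let DU := bounded_drift_clip sG GM lu mL mc Lg cg Lb c0.

(** Almost surely the tilted increment equals its clipped version [f'], which is bounded, so a
    conditional expectation exists; it is also a version for [f'], to which [cond_exp_le_chord]
    applies. *)
Lemma anchored_cgf_le s : 0 <= s -> exists2 phi, is_anchored_cgf P F E c n s phi &
  {ae P, forall w, (phi w <= psi_exact lo up c n s w)%E}.
Proof.
move=> s0; pose D := incr (lo n) (up n) (logE E n); pose U := drift (lo n) (up n) (c n).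
pose f w := expeR (- s%:E * (logE E n w - (c n w)%:E)).
pose f' w := expR (s * U w) * expR (- (s * D w)).
have mf : measurable_fun setT f.
  apply: measurableT_comp; first exact: measurable_expeR.
  apply: emeasurable_funM; first exact: measurable_cst.
  apply: emeasurable_funB => //; apply/measurable_EFinP.
  exact: (sub_measurableW sG GM).
have mU : measurable_fun setT U := sub_measurableW sG GM (bd_mU DU).
have mf' : measurable_fun setT f'.
  apply: measurable_funM; apply: measurableT_comp => //.
    exact: measurable_funM.
  by apply: measurableT_comp => //; apply: measurable_funM => //; exact: (bd_mD DU).
have f0 w : (0 <= f w)%E by exact: expeR_ge0.
have ff' : {ae P, forall w, f w = (f' w)%:E}.
  have := driftE sG GM lu mL mc Lg cg Lb c0.
  apply: filterS2 (incrE Lb) => w LE [_ cE].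
  rewrite /f LE {1}cE -EFinB -EFinN -EFinM /= /f' -expRD; congr (expR _)%:E.
  by rewrite /D /U; ring.
have f'r w : 0 <= f' w <= expR (s * r).
  rewrite mulr_ge0 ?expR_ge0//= -[leRHS]mulr1 ler_pM ?expR_ge0//.
    by rewrite ler_expR ler_wpM2l//; have /andP[] := bd_U DU w.
  by rewrite expR_le1 oppr_le0 mulr_ge0//; have /andP[] := bd_D DU w.
have fE A : measurable A -> (\int[P]_(w in A) f w = \int[P]_(w in A) (f' w)%:E)%E.
  move=> mA; apply: ge0_ae_eq_integral => //.
  - exact: measurable_funTS.
  - by apply/measurable_funTS/measurable_EFinP.
  - by move=> w _; rewrite lee_fin; have /andP[] := f'r w.
  - by apply: filterS ff' => w.
have foo : (\int[P]_w f w < +oo)%E.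
  by rewrite fE//; exact: (@integral_bounded_lty _ _ _ P setT f' (expR (s * r))).
have [g [fg [mg gg0 gE]]] := is_cond_exp_ex sG GM mf f0 foo.
exists (fun w => lne (g w)); first by exists g.
have := @cond_exp_le_chord _ _ _ _ _ sG GM _ _ _ r0 DU s g s0.
suff gf' : is_cond_exp_ge0 P G (fun w => (f' w)%:E) g.
  move=> /(_ gf'); apply: filterS2 (driftE sG GM lu mL mc Lg cg Lb c0) => w [gr cE] gle.
  have Ugap : U w = gap lo c n w by rewrite /gap cE /U addrC addKr.
  rewrite psi_exactE// -Ugap -/(log_range lo up n) -/U in gle *.
  have cp : 0 < chord r s (U w) by rewrite chord_gt0// Ugap.
  have -> : (s * U w + ln (chord r s (U w)))%:E =
      lne (expR (s * U w) * chord r s (U w))%:E.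
    by rewrite lne_EFin ?mulr_gt0 ?expR_gt0// lnM ?posrE ?expR_gt0// expRK.
  rewrite lee_lne// in_itv/= leey andbT.
    exact: gg0.
  by rewrite lee_fin mulr_ge0 ?expR_ge0 ?ltW.
by split => // A GA; rewrite gE// fE//; exact: GM.
Qed.
End cgf.
End majorant.

(** * Rate functions, optimal tilts, Pinsker's inequality and averaging over steps *)

Section rates.
Context {R : realType}.
Implicit Types s x y : R.

Lemma tilt_domy s : tilt_dom +oo%E s <-> 0 <= s.
Proof. by split => [[]//|s0]; split => //; rewrite ltry. Qed.

Lemma rate_quad_attained (R2 x : R) : 0 < R2 ->
  ((4 * x / R2 * x)%:E - Psi_quad R2 (4 * x / R2))%E = (2 * x ^+ 2 / R2)%:E.
Proof.
by move=> R20; rewrite /Psi_quad -EFinB; congr _%:E; field; rewrite gt_eqF.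
Qed.

(** Completing the square: the objective falls short of its maximum by
    [R2 / 8 * (s - 4 * x / R2) ^+ 2]. *)
Lemma rate_quad (R2 x : R) : 0 < R2 -> 0 <= x ->
  rate +oo%E (Psi_quad R2) x = (2 * x ^+ 2 / R2)%:E.
Proof.
move=> R20 x0; apply/eqP; rewrite eq_le; apply/andP; split.
  apply: ge_ereal_sup => _ [s _ <-]; rewrite /Psi_quad -EFinB lee_fin -subr_ge0.
  have -> : 2 * x ^+ 2 / R2 - (s * x - R2 * s ^+ 2 / 8) =
      R2 / 8 * (s - 4 * x / R2) ^+ 2 by field; rewrite gt_eqF.
  by rewrite mulr_ge0 ?sqr_ge0// divr_ge0// ltW.
apply: ereal_sup_ubound; exists (4 * x / R2); last exact: rate_quad_attained.
by apply/tilt_domy; rewrite divr_ge0 ?mulr_ge0// ltW.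
Qed.

Section exact.
Variables (t : nat) (r y : R).
Hypotheses (t0 : (0 < t)%N) (r0 : 0 < r) (y01 : 0 <= y <= 1).

Let t0R : 0 < t%:R :> R. Proof. by rewrite ltr0n. Qed.

(** The substitution [u = s * r] turns the objective into [t] times the one in [kl_sup]. *)
Lemma exact_objectiveE s x :
  ((s * x)%:E - Psi_exact t r y s)%E = (t%:R%:E *
   (- (s * r * (y - x / (t%:R * r))) - ln (y * expR (- (s * r)) + 1 - y))%:E)%E.
Proof.
rewrite /Psi_exact -EFinB -EFinM; congr _%:E.
by field; rewrite !gt_eqF.
Qed.

Lemma rate_exact x : 0 <= x ->
  rate +oo%E (Psi_exact t r y) x = (t%:R%:E * kl (y - x / (t%:R * r)) y)%E.
Proof.
move=> x0; rewrite -kl_sup//; last by rewrite gerBl divr_ge0// mulr_ge0 ?ltW.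
rewrite -ereal_sup_pZl//; congr ereal_sup; apply/seteqP; split => z /=.
  move=> [s /tilt_domy s0 <-]; rewrite exact_objectiveE; eexists; last by [].
  by exists (s * r) => //; rewrite mulr_ge0// ltW.
move=> [_ [u /= u0 <-] <-]; exists (u / r).
  by apply/tilt_domy; rewrite divr_ge0// ltW.
by rewrite exact_objectiveE divfK// gt_eqF.
Qed.

(** The tilt is the log odds ratio of [kl_attained] divided by [r], undoing [u = s * r]. It is
    nonnegative because [xt <= y]. *)
Lemma optimal_tilt_exact x : 0 <= x ->
  let xt := y - x / (t%:R * r) in 0 < xt -> y < 1 ->
  is_optimal_tilt +oo%E (Psi_exact t r y) x
    (r^-1 * ln (y * (1 - xt) / (xt * (1 - y)))).
Proof.
move=> x0 xt xt0 y1; have xty : xt <= y by rewrite gerBl divr_ge0// mulr_ge0 ?ltW.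
have y0 : 0 < y := lt_le_trans xt0 xty.
split.
  apply/tilt_domy; rewrite mulr_ge0 ?invr_ge0 ?(ltW r0)// ln_ge0//.
  rewrite ler_pdivlMr; last by rewrite mulr_gt0// subr_gt0.
  rewrite mul1r -subr_ge0.
  by rewrite (_ : _ - _ = y - xt) ?subr_ge0//; ring.
rewrite rate_exact// -/xt kl_attained ?xt0 ?y0 ?(le_lt_trans xty)//.
by rewrite exact_objectiveE [r^-1 * _]mulrC divfK// gt_eqF.
Qed.

End exact.

(** With [t = r = 1] both sides are conjugates evaluated at [y - x]; conjugation reverses the order
    of [Psi_exact] and [Psi_quad] given by Hoeffding's lemma. *)
Lemma pinsker_le x y : 0 <= y <= 1 -> x <= y -> ((2 * (x - y) ^+ 2)%:E <= kl x y)%E.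
Proof.
move=> y01 xy; have yx : 0 <= y - x by rewrite subr_ge0.
have := @rate_exact 1 1 y isT ltr01 y01 (y - x) yx.
rewrite !mulr1 divr1 mul1e subKr => <-.
have := @rate_quad 1 (y - x) ltr01 yx; rewrite divr1 -sqrrN opprB => <-.
apply: ge_ereal_sup => _ [s s_dom <-]; have /tilt_domy s0 := s_dom.
apply: le_ereal_sup_tmp; exists ((s * (y - x))%:E - Psi_exact 1 1 y s)%E;
  first by exists s.
rewrite leeB// lee_fin !mul1r !mulr1 mulrC.
exact: hoeffding_two_point.
Qed.

Lemma pinsker x y : 0 <= y <= 1 -> ((2 * (x - y) ^+ 2)%:E <= kl x y)%E.
Proof.
move=> y01; case/orP: (le_total x y) => xy; first exact: pinsker_le.
rewrite -klC [X in X ^+ 2](_ : _ = - (1 - x - (1 - y))); last by ring.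
by rewrite sqrrN; apply: pinsker_le; lra.
Qed.

Lemma mean_range (t : nat) (dn : nat -> R) (r : R) : (0 < t)%N -> 0 < r ->
  (forall n, (0 < n <= t)%N -> 0 <= dn n <= r) ->
  0 <= (\sum_(1 <= n < t.+1) dn n) / (t%:R * r) <= 1.
Proof.
move=> t0 r0 dnr; have tr0 : 0 < t%:R * r by rewrite mulr_gt0// ltr0n.
have sum0 : 0 <= \sum_(1 <= n < t.+1) dn n.
  rewrite big_seq; apply: sumr_ge0 => n; rewrite mem_index_iota ltnS => nt.
  by have /andP[] := dnr n nt.
rewrite divr_ge0 ?(ltW tr0)//= ler_pdivrMr// mul1r.
have -> : t%:R * r = \sum_(1 <= n < t.+1) r by rewrite sumr_const_nat subn1 mulr_natl.
rewrite big_seq [leRHS]big_seq; apply: ler_sum => n; rewrite mem_index_iota ltnS => nt.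
by have /andP[] := dnr n nt.
Qed.

(* The per-step bounds only grow when the range [r n] is enlarged to [r], and
   the logarithm lies below its tangent at the average [y]. *)
Lemma sum_chord_le (t : nat) (rn dn : nat -> R) (r s y : R) : (0 < t)%N -> 0 <= s ->
  (forall n, (0 < n <= t)%N -> 0 < rn n <= r) ->
  (forall n, (0 < n <= t)%N -> 0 <= dn n <= rn n) ->
  y = (\sum_(1 <= n < t.+1) dn n) / (t%:R * r) ->
  \sum_(1 <= n < t.+1) (s * dn n + ln (chord (rn n) s (dn n))) <=
  t%:R * (s * r * y + ln (y * expR (- (s * r)) + 1 - y)).
Proof.
move=> t0 s0 rnr dnr yE; have t0R : 0 < t%:R :> R by rewrite ltr0n.
have r0 : 0 < r.
  have /andP[h1 h2] : 0 < rn 1%N <= r by apply: rnr; rewrite t0.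
  exact: lt_le_trans h1 h2.
have tr0 : 0 < t%:R * r by rewrite mulr_gt0.
have dnr' n : (0 < n <= t)%N -> 0 <= dn n <= r.
  move=> nt; have /andP[d0 dr] := dnr n nt; have /andP[_ rr] := rnr n nt.
  by rewrite d0 (le_trans dr).
have y01 : 0 <= y <= 1 by rewrite yE; exact: mean_range.
set Z := y * expR (- (s * r)) + 1 - y; have Z0 : 0 < Z by exact: two_point_gt0.
(* The right side is the tangent of [ln] at [Z] composed with the chord over [[0, r]]. It is affine
   in [dn n], so its sum depends on the gaps only through their average. *)
have step n : (0 < n <= t)%N -> s * dn n + ln (chord (rn n) s (dn n)) <=
    (s + (expR (- (s * r)) - 1) / (r * Z)) * dn n + (ln Z + (1 - Z) / Z).
  move=> nt; have /andP[rn0 rr] := rnr n nt; have /andP[d0 dr] := dnr n nt.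
  have c0 : 0 < chord (rn n) s (dn n).
    by apply: lt_le_trans (chord_ge rn0 s _); rewrite ?expR_gt0 ?d0.
  have c0' : 0 < chord r s (dn n).
    by apply: lt_le_trans (chord_ge r0 s _); rewrite ?expR_gt0 ?dnr'.
  (* Both chords equal 1 at 0, and at [rn n] the wider one lies above the exponential, which is the
     value of the narrower one. *)
  have cle : chord (rn n) s (dn n) <= chord r s (dn n).
    have h := @chord_ge _ r r0 s (rn n); rewrite (ltW rn0) rr in h.
    have {}h := h isT; rewrite -subr_ge0.
    have -> : chord r s (dn n) - chord (rn n) s (dn n) =
        dn n / rn n * (chord r s (rn n) - expR (- (s * rn n))).
      by rewrite /chord; field; rewrite !gt_eqF.
    by rewrite mulr_ge0 ?subr_ge0// divr_ge0// ltW.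
  have lnle : ln (chord (rn n) s (dn n)) <= ln Z + (chord r s (dn n) / Z - 1).
    rewrite -lerBlDl -ln_div ?posrE//; apply: le_trans (ln_le_sub1 _) _.
      by rewrite divr_gt0.
    by rewrite lerD2r ler_pM2r// invr_gt0.
  have -> : (s + (expR (- (s * r)) - 1) / (r * Z)) * dn n + (ln Z + (1 - Z) / Z) =
      s * dn n + (ln Z + (chord r s (dn n) / Z - 1)).
    by rewrite /chord; field; rewrite !gt_eqF.
  by rewrite lerD2l.
apply: (@le_trans _ _ (\sum_(1 <= n < t.+1)
    ((s + (expR (- (s * r)) - 1) / (r * Z)) * dn n + (ln Z + (1 - Z) / Z)))).
  rewrite big_seq [leRHS]big_seq; apply: ler_sum => n; rewrite mem_index_iota ltnS.
  exact: step.
rewrite big_split/= -mulr_sumr sumr_const_nat subn1/= -[_ *+ t]mulr_natl.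
have -> : \sum_(1 <= n < t.+1) dn n = t%:R * r * y by rewrite yE mulrC divfK// gt_eqF.
(* At the average gap the chord over [[0, r]] takes the value [Z], so the first-order terms of the
   tangent cancel. *)
have ZE : y * (expR (- (s * r)) - 1) = Z - 1 by rewrite /Z; ring.
have -> : (s + (expR (- (s * r)) - 1) / (r * Z)) * (t%:R * r * y) +
    t%:R * (ln Z + (1 - Z) / Z) =
    t%:R * (s * r * y + ln Z + (y * (expR (- (s * r)) - 1) + (1 - Z)) / Z).
  by field; rewrite !gt_eqF.
by rewrite ZE addrA subrK subrr mul0r addr0.
Qed.

End rates.

(** * Assembly of the majorants, aggregates and error bounds *)

Lemma ae_ex d (T : measurableType d) (R : realType) (P : probability T R)
    (Q : T -> Prop) :
  {ae P, forall w, Q w} -> exists w, Q w.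
Proof.
move=> PQ; apply: (@filter_ex _ _ (ae_properfilter_algebraOfSetsType _) _ PQ).
by suff : (0 < P setT)%E by []; rewrite probability_setT; exact: lte01.
Qed.

Theorem corollary4p29 (R : realType) (d : measure_display) (T : measurableType d)
    (P0 P1 : probability T R) (F : nat -> set (set T))
    (E : nat -> T -> \bar R) (c : nat -> T -> R)
    (t : nat) (alpha C : R) (lo up : nat -> R)
    (hF : filtration F)
    (hP : locally_dominated P0 P1 F)
    (hE : betting_sequence P0 F E)
    (hc : drift_certificate P1 F E c)
    (ht : (0 < t)%N)
    (halpha : 0 < alpha < 1)
    (hC : {ae P1, forall w, C <= \sum_(1 <= n < t.+1) c n w})
    (hlu : forall n, (0 < n)%N -> lo n < up n)
    (hbd : forall n, (0 < n)%N ->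
       {ae P1, forall w, ((expR (lo n))%:E <= E n w <= (expR (up n))%:E)%E})
    (hgap : forall n, (0 < n)%N -> {ae P1, forall w, 0 <= gap lo c n w}) :
  (* equivalence of the two forms of the boundedness assumption *)
  (forall n w, (0 < n)%N ->
     ((expR (lo n))%:E <= E n w <= (expR (up n))%:E)%E <->
     ((lo n)%:E <= logE E n w <= (up n)%:E)%E) /\
  (forall n, (0 < n)%N -> {ae P1, forall w, 0 <= position lo up c n w <= 1}) /\
  is_majorant P1 F E c +oo%E (@psi_quad T R lo up) /\
  is_majorant P1 F E c +oo%E (psi_exact lo up c) /\
  (* psi_exact is the anchored cumulant generating function of the two-point
     law giving mass position to up and 1 - position to lo *)
  (forall n s w, (0 < n)%N -> 0 <= s -> 0 <= position lo up c n w <= 1 ->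
     psi_exact lo up c n s w =
     lne (\int[bernoulli_prob (position lo up c n w)]_b
       (expR (- (s * ((if b then up n else lo n) - c n w))))%:E)%E) /\
  (forall n s w, (0 < n)%N -> 0 <= s ->
     (psi_exact lo up c n s w <= psi_quad lo up n s w)%E) /\
  (* Azuma-Hoeffding form *)
  (forall R2 : R, \sum_(1 <= n < t.+1) log_range lo up n ^+ 2 <= R2 ->
     let Delta := excess alpha C in
     [/\ is_aggregate P1 c +oo%E (@psi_quad T R lo up) t C (Psi_quad R2),
         forall x, 0 <= x -> rate +oo%E (Psi_quad R2) x = (2 * x ^+ 2 / R2)%:E,
         is_optimal_tilt +oo%E (Psi_quad R2) Delta (4 * Delta / R2),
         (type2_seq P1 E alpha t <= type2 P1 E alpha t)%E
       & (type2 P1 E alpha t <= (expR (- (2 * Delta ^+ 2 / R2)))%:E)%E]) /\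
  (* exact binary-entropy form *)
  (forall (dn : nat -> R) (r : R),
     (forall n, (0 < n <= t)%N -> forall w, gap lo c n w = dn n) ->
     (forall n, (0 < n <= t)%N -> log_range lo up n <= r) ->
     let Delta := excess alpha C in
     let ybar := (\sum_(1 <= n < t.+1) dn n) / (t%:R * r) in
     let xt := ybar - Delta / (t%:R * r) in
     [/\ 0 <= ybar <= 1,
         is_aggregate P1 c +oo%E (psi_exact lo up c) t C (Psi_exact t r ybar),
         forall x, 0 <= x ->
           rate +oo%E (Psi_exact t r ybar) x =
           (t%:R%:E * kl (ybar - x / (t%:R * r)) ybar)%E,
         0 < xt -> ybar < 1 ->
           is_optimal_tilt +oo%E (Psi_exact t r ybar) Delta
             (r^-1 * ln (ybar * (1 - xt) / (xt * (1 - ybar))))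
       & [/\ (type2_seq P1 E alpha t <= type2 P1 E alpha t)%E,
             (type2 P1 E alpha t <= expeR (- (t%:R%:E * kl xt ybar)))%E
           & (expeR (- (t%:R%:E * kl xt ybar)) <=
              (expR (- (2 * Delta ^+ 2 / (t%:R * r ^+ 2))))%:E)%E]]) /\
  (* Pinsker's inequality *)
  (forall x y : R, 0 <= y <= 1 -> ((2 * (x - y) ^+ 2)%:E <= kl x y)%E).
Proof.
have [sF FM Fmono _] := hF.
have E0 n : (0 < n)%N -> forall w, (0 <= E n w)%E by move=> /hE[].
have smE n : (0 < n)%N -> sub_measurable (F n) (E n) by move=> /hE[].
have mE n : (0 < n)%N -> measurable_fun setT (E n).
  by move=> n0; exact: (sub_measurableW (sF n) (FM n) (smE n n0)).
have equiv n w : (0 < n)%N ->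
    ((expR (lo n))%:E <= E n w <= (expR (up n))%:E)%E <->
    ((lo n)%:E <= logE E n w <= (up n)%:E)%E.
  move=> n0; have : expeR (lne (E n w)) = E n w.
    by rewrite lneK// in_itv/= leey E0.
  by move=> <-; rewrite -![(expR _)%:E]/(expeR _%:E) !lee_expeR /logE.
have Lb n : (0 < n)%N -> {ae P1, forall w, ((lo n)%:E <= logE E n w <= (up n)%:E)%E}.
  by move=> n0; apply: filterS (hbd n n0) => w /equiv; exact.
pose r := log_range lo up.
have r0 n : (0 < n)%N -> 0 < r n by move=> n0; rewrite subr_gt0 hlu.
pose D n := incr (lo n) (up n) (logE E n); pose U n := drift (lo n) (up n) (c n).
have mL n : (0 < n)%N -> measurable_fun setT (logE E n).
  by move=> n0; apply: measurableT_comp (mE n n0); exact: measurable_lne.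
have DU n : (0 < n)%N -> bounded_drift P1 (F n.-1) (r n) (D n) (U n).
  move=> n0; have [mc [g Lg cg]] := hc n n0.
  have h := bounded_drift_clip (sF _) (FM _) (hlu n n0) (mL n n0) mc Lg cg (Lb n n0) (hgap n n0).
  exact: h.
have UE n : (0 < n)%N ->
    {ae P1, forall w, 0 <= gap lo c n w <= r n /\ c n w = lo n + U n w}.
  move=> n0; have [mc [g Lg cg]] := hc n n0.
  have h := driftE (sF _) (FM _) (hlu n n0) (mL n n0) mc Lg cg (Lb n n0) (hgap n n0).
  exact: h.
have cgf n s : (0 < n)%N -> 0 <= s -> exists2 phi, is_anchored_cgf P1 F E c n s phi &
    {ae P1, forall w, (phi w <= psi_exact lo up c n s w)%E}.
  move=> n0; have [mc [g Lg cg]] := hc n n0.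
  exact: (anchored_cgf_le (hlu n n0) hF (mE n n0) mc Lg cg (Lb n n0) (hgap n n0)).
have smD n : (0 < n)%N -> sub_measurable (F n) (D n).
  move=> n0; apply: measurableT_comp; first exact: measurable_clip.
  apply: measurable_funB => //; apply: measurableT_comp; first exact: fine_measurable.
  by apply: measurableT_comp (smE n n0); exact: measurable_lne.
have hCU : {ae P1, forall w, C <= \sum_(1 <= n < t.+1) (lo n + U n w)}.
  have : {ae P1, forall w n, (0 < n)%N -> c n w = lo n + U n w}.
    apply/ae_foralln => -[|n]; first exact/aeW.
    by apply: filterS (UE n.+1 isT) => w [].
  apply: filterS2 hC => w Cw cE; apply: le_trans Cw _.
  rewrite big_nat [leRHS]big_nat le_eqVlt; apply/orP; left; apply/eqP.
  by apply: eq_bigr => n /andP[n0 _]; exact: cE.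
have /andP[alpha0 _] := halpha.
(* The Chernoff bound at an arbitrary tilt and with arbitrary per-step exponents, instantiated once
   for each form of the bound. *)
have T2 s B : 0 <= s -> (forall n, (0 < n <= t)%N -> forall w,
      expR (s * U n w) * chord (r n) s (U n w) <= expR (B n)) ->
    (type2 P1 E alpha t <=
      (expR (\sum_(1 <= n < t.+1) B n - s * excess alpha C))%:E)%E.
  move=> s0 hB; apply: (type2_excess hF _ _ _ s0 hB E0 mE _ hCU alpha0) => n /andP[n0 _].
  - exact: r0.
  - exact: DU.
  - exact: smD.
  - exact: incrE (Lb n n0).
have Delta0 : 0 <= excess alpha C by rewrite le_max lexx orbT.
have seq_le : (type2_seq P1 E alpha t <= type2 P1 E alpha t)%E.
  exact: type2_seq_le.
split; first exact: equiv.
split.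
  move=> n n0; apply: filterS (UE n n0) => w [gr _].
  by rewrite position01// hlu.
split.
  move=> n n0; split => [w|s [s0 _]].
    by rewrite /psi_quad expr0n/= mulr0 mul0r.
  split => [w||].
  - by rewrite lee_fin divr_ge0// mulr_ge0 ?sqr_ge0.
  - exact: measurable_cst.
  - have [phi hphi phi_le] := cgf n s n0 s0; exists phi => //.
    apply: filterS phi_le => w /le_trans; apply.
    exact: (psi_exact_le_quad _ (hlu n n0)).
split.
  move=> n n0; split => [w|s [s0 _]].
    rewrite /psi_exact; case: ifP => // _.
    by rewrite !mul0r oppr0 expR0 mulr1 [_ + 1]addrC addrK ln1 addr0.
  split => [w||].
  - exact: (psi_exact_ge0 _ (hlu n n0)).
  - by have [mc _] := hc n n0; exact: measurable_psi_exact.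
  - exact: cgf.
split; first by move=> n s w n0; exact: (psi_exact_bernoulli (hlu n n0)).
split; first by move=> n s w n0; exact: (psi_exact_le_quad _ (hlu n n0)).
split.
  move=> R2 hR2 Delta.
  have R20 : 0 < R2.
    apply: lt_le_trans hR2; rewrite big_ltn//= ltr_wpDr ?exprn_gt0 ?r0//.
    by apply: sumr_ge0 => n _; exact: sqr_ge0.
  have sum_le s : \sum_(1 <= n < t.+1) (r n ^+ 2 * s ^+ 2 / 8) <= R2 * s ^+ 2 / 8.
    by rewrite -!mulr_suml -mulrA -[leRHS]mulrA; apply: ler_wpM2r hR2;
      rewrite divr_ge0 ?sqr_ge0.
  split.
  - split => // s _; apply/aeW => w; rewrite /psi_quad /Psi_quad sumEFin lee_fin.
    exact: sum_le.
  - by move=> x x0; exact: rate_quad.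
  - split; last by rewrite rate_quad_attained// rate_quad.
    by apply/tilt_domy; rewrite divr_ge0 ?(ltW R20)// mulr_ge0.
  - exact: seq_le.
  - have s0 : 0 <= 4 * Delta / R2 by rewrite divr_ge0 ?(ltW R20)// mulr_ge0.
    apply: le_trans (T2 _ (fun n => r n ^+ 2 * (4 * Delta / R2) ^+ 2 / 8) s0 _) _.
      move=> n /andP[n0 _] w; apply: chord_hoeffding => //; first exact: r0.
      exact: (bd_U (DU n n0)).
    rewrite lee_fin ler_expR -/Delta.
    apply: (@le_trans _ _ (R2 * (4 * Delta / R2) ^+ 2 / 8 - 4 * Delta / R2 * Delta)).
      by rewrite lerD2r sum_le.
    by rewrite le_eqVlt; apply/orP; left; apply/eqP; field; rewrite gt_eqF.
split; last exact: pinsker.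
move=> dn rr hdn hrr Delta ybar xt.
(* The gap is the constant [dn n], so its almost sure bounds can be read off at a single point. *)
have dnr n : (0 < n <= t)%N -> 0 <= dn n <= r n.
  move=> nt; have /andP[n0 _] := nt; have [w [gr _]] := ae_ex (UE n n0).
  by rewrite -(hdn n nt w).
have rnr n : (0 < n <= t)%N -> 0 < r n <= rr.
  by move=> nt; have /andP[n0 _] := nt; rewrite r0// hrr.
have rr0 : 0 < rr by have /andP[h1 h2] := rnr 1%N ht; exact: lt_le_trans h1 h2.
have t0R : 0 < t%:R :> R by rewrite ltr0n.
have y01 : 0 <= ybar <= 1.
  apply: mean_range => // n nt; have /andP[d0 dr] := dnr n nt.
  by have /andP[_ h] := rnr n nt; rewrite d0 (le_trans dr).
pose B s n := s * dn n + ln (chord (r n) s (dn n)).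
have sum_le s : 0 <= s -> ((\sum_(1 <= n < t.+1) B s n)%:E <= Psi_exact t rr ybar s)%E.
  by move=> s0; rewrite lee_fin; exact: sum_chord_le.
have UdE n w : (0 < n <= t)%N -> U n w = dn n.
  move=> nt; rewrite /U /drift -[c n w - lo n]/(gap lo c n w) (hdn n nt).
  by rewrite clip_id// dnr.
have rateE x : 0 <= x -> rate +oo%E (Psi_exact t rr ybar) x =
    (t%:R%:E * kl (ybar - x / (t%:R * rr)) ybar)%E.
  by move=> x0; exact: rate_exact.
split.
- exact: y01.
- split => // s /tilt_domy s0; apply/aeW => w; apply: le_trans (sum_le s s0).
  rewrite -sumEFin big_nat [leRHS]big_nat; apply: lee_sum => n nt.
  rewrite psi_exactE ?hdn// ?hlu//; last by rewrite dnr.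
  by case/andP: nt.
- exact: rateE.
- by move=> xt0 y1; exact: optimal_tilt_exact.
split.
- exact: seq_le.
(* The Chernoff bound is taken at every [s >= 0] and the supremum is formed afterwards. This also
   covers the boundary cases, where the formula for the optimal tilt is not asserted and the entropy
   may be infinite. *)
- rewrite -rateE//; set p := type2 P1 E alpha t.
  have p0 : (0 <= p)%E by exact: measure_ge0.
  have pK : expeR (lne p) = p by rewrite lneK// in_itv/= leey p0.
  rewrite -[leLHS]pK lee_expeR leeNr.
  apply: ge_ereal_sup => _ [s /tilt_domy s0 <-]; rewrite leeNr.
  rewrite -lee_expeR pK; apply: le_trans (T2 s (B s) s0 _) _.
    move=> n nt w; rewrite UdE// expRD lnK// posrE; apply: chord_gt0; last exact: dnr.
    by case/andP: nt => n0 _; exact: hlu.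
  rewrite -[leLHS]/(expeR _%:E) lee_expeR /Psi_exact -EFinB -EFinN lee_fin opprB lerD2r.
  by have := sum_le s s0; rewrite lee_fin.
- rewrite -[leRHS]/(expeR _%:E) lee_expeR EFinN leeN2.
  (* Here [xt] and [ybar] differ by [Delta / (t r)], so [t] times Pinsker's lower bound is
     [2 Delta^2 / (t r^2)]. *)
  apply: (@le_trans _ _ (t%:R%:E * (2 * (xt - ybar) ^+ 2)%:E)%E).
    rewrite -EFinM lee_fin le_eqVlt; apply/orP; left; apply/eqP; rewrite /xt.
    by field; rewrite !gt_eqF.
  by rewrite lee_pmul2l ?lte_fin//; exact: pinsker.
Qed.
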